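(* Let $K/k$ be a separable field extension of degree $5$ which is not Hopf Galois, let $\widetilde{K}/k$ be its Galois closure and $G=\operatorname{Gal}(\widetilde{K}/k)$ (so that $G\simeq A_5$ or $G\simeq S_5$). The smallest degree $[F:k]$ among the fields $F$ such that $K\subseteq F\subseteq\widetilde{K}$ and $F/k$ is Hopf Galois is $60$. More precisely, this smallest degree is attained for $F=\widetilde{K}$ in the case $G\simeq A_5$, and for some field $F$ such that $F/k$ is almost classically Galois in the case $G\simeq S_5$.
   Context: A finite extension of fields $L/k$ is called Hopf Galois if there exists a finite cocommutative $k$-Hopf algebra $H$ such that $L$ is an $H$-module algebra and the $k$-linear map $j: L\otimes_k H\to \operatorname{End}_k(L)$, $j(s\otimes h)(t)=s(ht)$ for $h\in H$, $s,t\in L$, is bijective. Let $L/k$ be a finite separable extension with Galois closure $\widetilde{L}/k$, $\Gamma=\operatorname{Gal}(\widetilde{L}/k)$, $\Gamma'=\operatorname{Gal}(\widetilde{L}/L)$, and let $\lambda:\Gamma\to\operatorname{Sym}(\Gamma/\Gamma')$ be the left translation action on left cosets. $L/k$ is called almost classically Galois if there is a regular (i.e. sharply transitive) subgroup $N$ of $\operatorname{Sym}(\Gamma/\Gamma')$ which is normalized by $\lambda(\Gamma)$ and contained in $\lambda(\Gamma)$; equivalently, $\Gamma'$ has a normal complement in $\Gamma$. It is known (Greither–Pareigis) that a separable extension of degree $5$ fails to be Hopf Galois exactly when the Galois group of its Galois closure is isomorphic to $A_5$ or $S_5$. *)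

(* Defs.v *)
From HB Require Import structures.
From mathcomp Require Import all_boot all_order all_algebra.
From mathcomp Require Import all_fingroup all_solvable all_field.

Set Implicit Arguments.
Unset Strict Implicit.
Unset Printing Implicit Defensive.

Import GRing.Theory.
Local Open Scope ring_scope.

Reserved Notation "u \ox v" (at level 40, left associativity).

Section Tensor.
Variable k : fieldType.

(* U (x) V is modelled by matrices over the bases vbasis {:U} and vbasis {:V};
   the pure tensor u (x) v is the rank-one matrix of products of coordinates.
   [tens_bilinear], [tlift_tens] and [tlift_uniq] give the universal property,
   so nothing below depends on the choice of bases. *)
Definition tensor (U V : vectType k) : vectType k :=
  'M[k]_(\dim {:U}, \dim {:V}).

Definition tens (U V : vectType k) (u : U) (v : V) : tensor U V :=
  \matrix_(i, j) (coord (vbasis {:U}) i u * coord (vbasis {:V}) j v).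

(* The map U (x) V -> W induced by a bilinear map f : U -> V -> W; in Sweedler
   notation, [tlift f (comul h)] is the sum of the f h_(1) h_(2). *)
Definition tlift (U V : vectType k) (W : lmodType k) (f : U -> V -> W)
    (x : tensor U V) : W :=
  \sum_i \sum_j (x : 'M[k]_(_, _)) i j *: f (vbasis {:U})`_i (vbasis {:V})`_j.

Definition bilinear_fun (U V : vectType k) (W : lmodType k)
    (f : U -> V -> W) : Prop :=
  (forall u, linear (f u)) /\ (forall v, linear (fun u => f u v)).

Lemma tens_bilinear (U V : vectType k) : bilinear_fun (@tens U V).
Proof.
split=> [u | v] a x y; apply/matrixP=> i j; rewrite !mxE linearP /=.
  by rewrite mulrDr mulrCA.
by rewrite mulrDl mulrA.
Qed.

Lemma tlift_linear (U V : vectType k) (W : lmodType k) (f : U -> V -> W) :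
  linear (tlift f).
Proof.
move=> a x y; rewrite /tlift scaler_sumr -big_split /=.
apply: eq_bigr => i _; rewrite scaler_sumr -big_split /=.
by apply: eq_bigr => j _; rewrite !mxE scalerDl scalerA.
Qed.

Lemma tlift_tens (U V : vectType k) (W : lmodType k) (f : U -> V -> W) u v :
  bilinear_fun f -> tlift f (tens u v) = f u v.
Proof.
case=> fr fl.
have frZ w (I : finType) (c : I -> k) (b : I -> V) :
  f w (\sum_i c i *: b i) = \sum_i c i *: f w (b i).
  have f0 : f w 0 = 0.
    have := fr w 1 0 0; rewrite !scale1r addr0 => e.
    by apply: (addrI (f w 0)); rewrite addr0 -e.
  apply: (big_ind2 (fun x y => f w x = y)) => // [x x' y y' <- <- | i _].
    by have := fr w 1 x y; rewrite !scale1r.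
  by have := fr w (c i) (b i) 0; rewrite !addr0 f0 addr0.
have flZ w (I : finType) (c : I -> k) (b : I -> U) :
  f (\sum_i c i *: b i) w = \sum_i c i *: f (b i) w.
  have f0 : f 0 w = 0.
    have := fl w 1 0 0; rewrite !scale1r addr0 => e.
    by apply: (addrI (f 0 w)); rewrite addr0 -e.
  apply: (big_ind2 (fun x y => f x w = y)) => // [x x' y y' <- <- | i _].
    by have := fl w 1 x y; rewrite !scale1r.
  by have := fl w (c i) (b i) 0; rewrite !addr0 f0 addr0.
rewrite [in RHS](coord_vbasis (memvf u)) flZ; apply: eq_bigr => i _.
rewrite [in RHS](coord_vbasis (memvf v)) frZ scaler_sumr.
by apply: eq_bigr => j _; rewrite scalerA mxE.
Qed.

Lemma tlift_uniq (U V : vectType k) (W : lmodType k)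
    (g : {linear tensor U V -> W}) x :
  g x = tlift (fun u v => g (tens u v)) x.
Proof.
rewrite {1}[x](matrix_sum_delta (x : 'M[k]_(_, _))) linear_sum.
apply: eq_bigr => i _; rewrite linear_sum; apply: eq_bigr => j _.
rewrite linearZ /=; congr (_ *: g _); apply/matrixP=> i' j'.
rewrite !mxE !coord_free ?(basis_free (vbasisP _)) //.
by rewrite -natrM mulnb ![_ == i']eq_sym ![_ == j']eq_sym.
Qed.

End Tensor.

Notation "u \ox v" := (tens u v) : ring_scope.

(* falgType k is the type of nonzero finite-dimensional unital associative
   k-algebras, so these are the finite Hopf algebras. *)
Record finHopfAlgebra (k : fieldType) := FinHopfAlgebra {
  hopf_alg :> falgType k;
  comul : {linear hopf_alg -> tensor hopf_alg hopf_alg};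
  counit : {linear hopf_alg -> k^o};
  antipode : {linear hopf_alg -> hopf_alg};
  comulA : forall h,
    tlift (fun a b => tlift (fun a1 a2 => a1 \ox (a2 \ox b)) (comul a))
          (comul h)
    = tlift (fun a b => a \ox comul b) (comul h);
  counitl : forall h, tlift (fun a b => counit a *: b) (comul h) = h;
  counitr : forall h, tlift (fun a b => counit b *: a) (comul h) = h;
  comul1 : comul 1 = 1 \ox 1;
  comulM : forall a b, comul (a * b) =
    tlift (fun a1 a2 => tlift (fun b1 b2 => (a1 * b1) \ox (a2 * b2)) (comul b))
          (comul a);
  counit1 : counit 1 = 1;
  counitM : forall a b, counit (a * b) = counit a * counit b;
  antipodel : forall h,
    tlift (fun a b => antipode a * b) (comul h) = (counit h)%:A;
  antipoder : forall h,
    tlift (fun a b => a * antipode b) (comul h) = (counit h)%:A }.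

Section HopfGalois.
Variables (k : fieldType).

Definition cocommutative (H : finHopfAlgebra k) : Prop :=
  forall h : H, tlift (fun a b => b \ox a) (comul H h) = comul H h.

Definition module_algebra (H : finHopfAlgebra k) (L : falgType k)
    (act : {linear H -> 'End(L)}) : Prop :=
  [/\ forall t, act 1 t = t,
      forall a b t, act (a * b) t = act a (act b t),
      forall h, act h 1 = (counit H h)%:A
    & forall h s t,
        act h (s * t) = tlift (fun a b => act a s * act b t) (comul H h)].

Definition hopf_galois_map (H : finHopfAlgebra k) (L : falgType k)
    (act : {linear H -> 'End(L)}) : tensor L H -> 'End(L) :=
  tlift (fun s h => (amull s \o act h)%VF).

Lemma hopf_galois_mapE (H : finHopfAlgebra k) (L : falgType k)
    (act : {linear H -> 'End(L)}) (s : L) (h : H) (t : L) :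
  hopf_galois_map act (s \ox h) t = s * act h t.
Proof.
rewrite /hopf_galois_map tlift_tens ?comp_lfunE ?lfunE //.
split=> [u | v] a x y; apply/lfunP => z.
  rewrite add_lfunE scale_lfunE !comp_lfunE !linearP add_lfunE scale_lfunE.
  by rewrite !lfunE /= mulrDr scalerAr.
by rewrite add_lfunE scale_lfunE !comp_lfunE !lfunE /= mulrDl scalerAl.
Qed.

Definition hopf_galois (L : fieldExtType k) : Prop :=
  exists (H : finHopfAlgebra k) (act : {linear H -> 'End(L)}),
    [/\ cocommutative H, module_algebra act & bijective (hopf_galois_map act)].

End HopfGalois.

Section AlmostClassical.
Local Open Scope group_scope.

(* For automorphism groups, the product of gal_of is x * y = y \o x, so that
   the left coset s \o H of the usual convention is the right coset H :* s
   here, and left translation by t is right multiplication 'Rs by t.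
   Permutations are composed with the same convention. *)
Definition translations (gT : finGroupType) (G H : {group gT}) :
    {group {perm {set gT}}} :=
  (restr_perm (rcosets H G) @* (actperm 'Rs @* G))%G.

Definition sharply_transitive (T : finType) (N : {group {perm T}})
    (S : {set T}) : Prop :=
  {in S &, forall x y, exists! s, s \in N /\ s x = y}.

(* Sym(G/H) is the group perm.Sym (rcosets H G) of permutations of {set gT} fixing
   everything outside rcosets H G. *)
Definition has_normal_regular (gT : finGroupType) (G H : {group gT}) : Prop :=
  exists N : {group {perm {set gT}}},
    [/\ N \subset perm.Sym (rcosets H G),
        sharply_transitive N (rcosets H G),
        translations G H \subset 'N(N)
      & N \subset translations G H].

Lemma translationsE (gT : finGroupType) (G H : {group gT})
    (p : {perm {set gT}}) :
  reflect (exists2 g, g \in G &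
             [/\ p \in perm.Sym (rcosets H G)
               & {in rcosets H G, forall X : {set gT}, p X = X :* g}])
          (p \in translations G H).
Proof.
have stab g : g \in G -> actperm 'Rs g \in 'N(rcosets H G | 'P).
  move=> Gg; apply/astabsP=> X; rewrite /= /aperm actpermE /= rcosetE.
  apply/rcosetsP/rcosetsP=> [[x Gx eX] | [x Gx ->]].
    exists (x * g^-1); first by rewrite groupM ?groupV.
    by rewrite rcosetM -eX rcosetK.
  by exists (x * g); rewrite ?groupM // rcosetM.
apply: (iffP morphimP) => [[q _ /morphimP[g _ Gg ->] ->] | [g Gg [pS pE]]].
  exists g => //; split; first by rewrite inE restr_perm_on.
  by move=> X SX; rewrite restr_permE ?stab //= actpermE /= rcosetE.
exists (actperm 'Rs g); rewrite ?stab //; first by rewrite mem_morphim ?inE.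
rewrite inE in pS; apply/permP=> X; have [SX | nSX] := boolP (X \in rcosets H G).
  by rewrite restr_permE ?stab //= pE // actpermE /= rcosetE.
by rewrite (out_perm pS) // (out_perm (restr_perm_on _ _)).
Qed.

End AlmostClassical.

Section Fields.
Variables (k : fieldType) (L : splittingFieldType k).
Implicit Types K M F : {subfield L}.

Definition galois_closure K M : Prop :=
  [/\ (K <= M)%VS, galois 1 M
    & forall E : {subfield L}, (K <= E)%VS -> galois 1 E -> (M <= E)%VS].

Definition almost_classically_galois F : Prop :=
  exists2 M : {subfield L}, galois_closure F M
    & has_normal_regular 'Gal(M / 1)%G 'Gal(M / F)%G.

Definition hopf_galois_between K M F : Prop :=
  [/\ (K <= F)%VS, (F <= M)%VS & hopf_galois (subvs_of F)].

Definition smallest_hopf_galois_degree K M (d : nat) : Prop :=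
  (exists2 F : {subfield L}, hopf_galois_between K M F & \dim F = d)
  /\ (forall F : {subfield L}, hopf_galois_between K M F -> (d <= \dim F)%N).

End Fields.

(* Main.v *)
(* This uses the Greither-Pareigis correspondence, in both directions.

   If N is a normal complement of Gal(M/F) in G = Gal(M/k), then the algebra of
   equivariant functions N -> M, with G acting on N by conjugation through G / N,
   is a cocommutative Hopf algebra H making F Hopf Galois.  By Galois descent H
   spans M^N over M, so all identities can be checked on the values at points of N.

   Conversely, if H makes F Hopf Galois, then M (x) H is identified with
   Hom_k(F, M), and the elements of M (x) H corresponding to embeddings F -> M are
   grouplike; they act on the set of all embeddings, i.e. on the cosets of
   Gal(M/F), as a regular group N normalised by G.

   For the closure M of K of degree 5, G is a subgroup of S_5.  Either its 5-Sylow
   subgroup is a normal complement of Gal(M/K), and K is Hopf Galois, or G contains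
   A_5.  In the second case let F between K and M be Hopf Galois of degree below 60:
   then N has order 5, 10, 15, 20, 30 or 40, hence a characteristic subgroup P of
   order 5, whose automorphism group is abelian, so that A_5 centralises P.  This
   forces Gal(M/F) to meet A_5 trivially, that is [F : k] >= 60.  Degree 60 is
   reached by M if G = A_5 and by the fixed field of a transposition if G = S_5. *)

From HB Require Import structures.
Require Import Defs.
From mathcomp Require Import all_boot all_order all_algebra.
From mathcomp Require Import all_fingroup all_solvable all_field.
From mathcomp Require Import ring.

Set Implicit Arguments.
Unset Strict Implicit.
Unset Printing Implicit Defensive.

Import GRing.Theory.

Local Open Scope group_scope.

(** * Finite groups *)

(** Elements of T act on the cyclic group P by power maps, and these commute, so [a * b] and [b * a]
    conjugate P in the same way. *)
Lemma der1_cent_cyclic (gT : finGroupType) (T P : {group gT}) :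
  cyclic P -> T \subset 'N(P) -> T^`(1) \subset 'C(P).
Proof.
case/cyclicP=> x defP nPT; rewrite gen_subG.
apply/subsetP => _ /imset2P[a b Ta Tb ->].
have Px z : z \in T -> x ^ z \in <[x]>.
  by move=> Tz; rewrite -defP memJ_norm ?(subsetP nPT) // defP cycle_id.
have cab y : y \in P -> y ^ (a * b) = y ^ (b * a).
  rewrite defP => /cycleP[n ->]; have /cycleP[i xa] := Px a Ta.
  have /cycleP[j xb] := Px b Tb.
  by rewrite !conjXg !conjgM xa xb !conjXg xa xb -[x ^+ j ^+ i]expgM mulnC expgM.
apply/centP => y Py; apply/commute_sym/commgP/conjg_fixP.
have -> : [~ a, b] = (b * a)^-1 * (a * b) by rewrite commgEl conjgE invMg !mulgA.
have nPba : (b * a)^-1 \in 'N(P) by rewrite groupV (subsetP nPT) // groupM.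
by rewrite conjgM cab ?conjgKV // memJ_norm.
Qed.

(* The sign of the regular representation is nontrivial on an involution, which
   acts as a product of m transpositions. *)
Lemma double_odd_index2 (gT : finGroupType) (m : nat) :
  #|[set: gT]| = m.*2 -> odd m ->
  exists2 M : {group gT}, M <| [set: gT] & #|M| = m.
Proof.
move=> gTm om; have [|x _ ox] := @Cauchy _ 2 [set: gT]%G isT.
  by rewrite gTm -muln2 dvdn_mull.
pose r (y : gT) : {perm gT} := actperm 'R y.
have rM y z : r (y * z) = r y * r z by rewrite /r morphM ?inE.
(* The orbits of x are the m cosets of [<[x]>], so the sign is the parity of [m.*2 + m]. *)
have rx : odd_perm (r x).
  rewrite /odd_perm -{1}cardsT gTm odd_double /=.
  have -> : porbits (r x) = lcosets <[x]> [set: gT].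
    by apply/setP => B; apply/imsetP/lcosetsP => -[y _ ->]; exists y;
      rewrite ?inE // ?porbit_actperm ?inE ?orbitR.
  by rewrite card_lcosets -divgS ?subsetT // gTm -orderE ox -mul2n mulKn.
pose M := [set y | ~~ odd_perm (r y)].
have gM : group_set M.
  apply/group_setP; split=> [|y z]; first by rewrite inE /r morph1 odd_perm1.
  by rewrite !inE rM odd_permM => /negPf-> /negPf->.
exists (Group gM).
  apply/andP; split; first exact: subsetT.
  apply/subsetP => y _; rewrite inE; apply/subsetP => _ /imsetP[z Mz ->].
  have rJ : r (z ^ y) = r z ^ r y by rewrite /r morphJ ?inE.
  by move: Mz; rewrite !inE rJ odd_permJ.
have cov : [set: gT] = M :|: M :* x.
  apply/setP => y; rewrite !inE mem_rcoset inE rM odd_permM.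
  by rewrite [r x^-1]morphV ?inE // odd_permV rx; case: odd_perm.
have dis : [disjoint M & M :* x].
  apply/pred0P => y; rewrite /= mem_rcoset !inE rM odd_permM.
  by rewrite [r x^-1]morphV ?inE // odd_permV rx; case: odd_perm.
apply/eqP; rewrite -(eqn_pmul2l (isT : 0 < 2)%N) !mul2n -gTm cov.
by rewrite cardsU disjoint_setI0 // cards0 subn0 card_rcoset addnn.
Qed.

Lemma unique_Sylow_char (gT : finGroupType) (p : nat) (G : {group gT}) :
  #|'Syl_p(G)| = 1%N -> exists2 P : {group gT}, P \char G & p.-Sylow(G) P.
Proof.
move=> /eqP/normal_sylowP[P sylP nsPG]; exists P => //.
by rewrite -(normal_Hall_pcore sylP nsPG) pcore_char.
Qed.

(** The number of Sylow subgroups divides n and is 1 modulo p; for a concrete n the last hypothesis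
    is checked by computation. *)
Lemma card_Syl_eq1 (gT : finGroupType) (p n : nat) (G : {group gT}) :
  prime p -> #|G| = n ->
  all (fun d => (d %% p == 1) ==> (d == 1))%N (divisors n) -> #|'Syl_p(G)| = 1%N.
Proof.
move=> p_pr Gn /allP/(_ #|'Syl_p(G)|).
rewrite -dvdn_divisors -?Gn ?cardG_gt0 // => /(_ (card_Syl_dvd p G)).
by rewrite card_Syl_mod // => /eqP.
Qed.

Lemma card5_char (gT : finGroupType) (N : {group gT}) :
  #|N| \in [:: 5; 10; 15; 20; 30; 40] ->
  exists2 P : {group gT}, P \char N & #|P| = 5.
Proof.
move=> cN; have [P chP sylP] : exists2 P : {group gT}, P \char N & 5.-Sylow(N) P.
  apply: unique_Sylow_char; move: cN; rewrite !inE.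
  move=> /or4P[/eqP N5|/eqP N5|/eqP N5|/or3P[/eqP N5|/eqP N5|/eqP N5]];
    try by apply: card_Syl_eq1 N5 _.
  (* Order 30 escapes the count, since 6 divides 30. The subgroup of order 15 has a unique 5-Sylow
     subgroup, which is then normal in N. *)
  have [||M nsM M15] := @double_odd_index2 (subg_of N) 15 => //.
    by rewrite -(card_injm (injm_sgval N) (subxx _)) im_sgval.
  have [P chP sylP] := unique_Sylow_char (card_Syl_eq1 (isT : prime 5) M15 isT).
  have nsP : sgval @* P <| N.
    by rewrite -[X in _ <| X](im_sgval N) morphim_normal // (char_normal_trans chP).
  apply/eqP/normal_sylowP; exists (sgval @* P)%G => //.
  rewrite pHallE normal_sub // card_injm ?injm_sgval ?subsetT //.
  by rewrite (card_Hall sylP) M15 N5 !p_part.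
exists P; rewrite // (card_Hall sylP) p_part; move: cN; rewrite !inE.
by move=> /or4P[/eqP->|/eqP->|/eqP->|/or3P[/eqP->|/eqP->|/eqP->]].
Qed.

(** * Translations of cosets and regular subgroups *)

Section Translations.

Variables (gT : finGroupType) (G H : {group gT}).

(** [restr_perm] returns the identity on a permutation that does not stabilise the cosets, so the
    value is meaningful for g in G. *)
Definition translation g := restr_perm (rcosets H G) (actperm 'Rs g).

Lemma translation_stab g : g \in G -> actperm 'Rs g \in 'N(rcosets H G | 'P).
Proof.
move=> Gg; apply/astabsP => Y; rewrite /= /aperm actpermE /= rcosetE.
apply/rcosetsP/rcosetsP=> [[x Gx eY] | [x Gx ->]].
  by exists (x * g^-1); rewrite ?groupM ?groupV // rcosetM -eY rcosetK.
by exists (x * g); rewrite ?groupM // rcosetM.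
Qed.

Lemma translationE g Y : g \in G -> Y \in rcosets H G -> translation g Y = Y :* g.
Proof.
by move=> Gg XY; rewrite restr_permE ?translation_stab // actpermE /= rcosetE.
Qed.

Lemma translations_ofP (A : {set gT}) t : A \subset G ->
  reflect (exists2 g, g \in A & t = translation g)
          (t \in restr_perm (rcosets H G) @* (actperm 'Rs @* A)).
Proof.
move=> sAG; apply: (iffP morphimP) => [[_ _ /morphimP[g _ Ag ->] ->] | [g Ag ->]].
  by exists g.
exists (actperm 'Rs g) => //; first by rewrite translation_stab ?(subsetP sAG).
by rewrite mem_morphim ?inE.
Qed.

End Translations.

Arguments translations_ofP {gT G H A t}.

(* A 5-element h moving the base point inside its P-orbit normalises the
   stabiliser D of the base point in the derived group, since that stabiliser is
   the same at all points of the orbit; and the conjugates of K under h have the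
   trivial intersection gcore K G. *)
Lemma der1_leq_index (gT : finGroupType) (p : nat) (G K H : {group gT})
    (N P : {group {perm {set gT}}}) :
  prime p -> H \subset K -> K \subset G -> #|G : K| = p -> coprime #|K| p ->
  gcore K G = 1 ->
  N \subset perm.Sym (rcosets H G) -> sharply_transitive N (rcosets H G) ->
  translations G H \subset 'N(N) -> P \char N -> #|P| = p ->
  (#|G^`(1)| <= #|G : H|)%N.
Proof.
move=> p_pr sHK sKG iGK coKp coreK sNX trN nNT chP cP.
have sHG := subset_trans sHK sKG.
have sPN := char_sub chP.
pose T := translations G H; pose X := rcosets H G.
have nPT : T \subset 'N(P) := char_norm_trans chP nNT.
have cPT : T^`(1) \subset 'C(P).
  by apply: der1_cent_cyclic => //; rewrite prime_cyclic // cP.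
pose t := translation G H.
have XH : H :* 1 \in X by apply/rcosetsP; exists 1; rewrite ?group1.
have tE g Y : g \in G -> Y \in X -> t g Y = Y :* g by apply: translationE.
have tT g : g \in G -> t g \in T.
  by move=> Gg; apply/(translations_ofP (subxx G)); exists g.
have stabG : actperm 'Rs @* G \subset 'N(X | 'P).
  by apply/subsetP => _ /morphimP[g _ Gg ->]; apply: translation_stab.
have sDG := der_sub 1 G.
have tD g : g \in G^`(1) -> t g \in 'C(P).
  move=> Dg; apply: (subsetP cPT); rewrite /T /translations /=.
  rewrite -morphim_der ?stabG // -morphim_der ?subsetT //.
  by apply/(translations_ofP sDG); exists g.
have PX n Y : n \in P -> Y \in X -> n Y \in X.
  move=> Pn XY; have := subsetP sNX _ (subsetP sPN _ Pn); rewrite inE => nX.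
  by rewrite (perm_closed Y nX).
pose D := (H :&: G^`(1))%G.
pose B := [set (n : {perm _}) (H :* 1) | n in P].
have cB : #|B| = p.
  rewrite card_in_imset // => n n' Pn Pn' e.
  have [n0 [_ un]] := trN _ _ XH (PX _ _ Pn XH).
  by rewrite -(un n) ?(un n') // ?(subsetP sPN).
(* The elements carrying the base coset into its P-orbit B. Translations normalise P, so S is a
   group; its index over H is the size p of B. *)
pose S := [set g in G | H :* g \in B].
have gS : group_set S.
  apply/group_setP; split=> [|g g'].
    by rewrite inE group1; apply/imsetP; exists 1; rewrite ?group1 ?perm1.
  rewrite !inE => /andP[Gg /imsetP[n Pn en]] /andP[Gg' /imsetP[n' Pn' en']].
  rewrite groupM //; apply/imsetP; exists (n' * n ^ t g').
    by rewrite groupM // memJ_norm // (subsetP nPT) ?tT.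
  have e1 : H :* g' = t g' (H :* 1) by rewrite tE // -rcosetM mul1g.
  by rewrite rcosetM en permM -en' e1 permJ tE ?PX.
have sHS : H \subset S.
  apply/subsetP => g Hg; rewrite inE (subsetP sHG) //; apply/imsetP.
  by exists 1; rewrite ?group1 // perm1 rcoset1 rcoset_id.
have iSH : #|Group gS : H| = p.
  rewrite -cB; congr #|pred_of_set _|; apply/setP => Y; apply/rcosetsP/idP.
    by case=> g; rewrite inE => /andP[_ BY] ->.
  move=> BY; have [n Pn eY] := imsetP BY.
  have /rcosetsP[g Gg eg] : Y \in X by rewrite eY PX.
  by exists g; rewrite // inE Gg -eg.
have [|h Sh oh] := @Cauchy _ p (Group gS) p_pr.
  by rewrite -iSH -(Lagrange (sHS : H \subset Group gS)) dvdn_mull.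
move: Sh; rewrite inE => /andP[Gh /imsetP[n Pn eh]].
have nDh : <[h]> \subset 'N(D).
  rewrite cycle_subG -groupV inE; apply/subsetP => _ /imsetP[d + ->].
  rewrite inE => /andP[Hd dd]; have Gd := subsetP sDG d dd.
  rewrite inE; apply/andP; split; last first.
    by rewrite memJ_norm ?groupV ?(subsetP (der_norm 1 G)).
  rewrite conjgE invgK mulgA -mem_rcoset; apply/rcoset_eqP.
  rewrite rcosetM eh -tE ?PX // -permM -(centP (tD d dd) n Pn) permM tE //.
  by rewrite -rcosetM mul1g rcoset1 rcoset_id.
have sDgcore : D \subset gcore K G.
  (* Modulo K, all of G comes from [<[h]>], which normalises D; hence every conjugate of K contains
     D. *)
  have defG : K * <[h]> = G.
    have coh : coprime #|K| #|<[h]>| by rewrite -orderE oh.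
    apply/eqP; rewrite eqEcard mul_subG ?cycle_subG //= (coprime_cardMg coh).
    by rewrite -orderE oh -iGK Lagrange.
  apply/bigcapsP => x; rewrite -defG => /mulsgP[a c Ka hc ->{x}].
  rewrite conjsgM conjGid // -(normP (subsetP nDh c hc)) conjSg.
  by rewrite subIset ?sHK.
have tiD : G^`(1) :&: H = 1 by apply/trivgP; rewrite /= setIC -coreK.
rewrite -(leq_pmul2l (cardG_gt0 H)) Lagrange // mulnC -(TI_cardMg tiD).
by rewrite subset_leq_card // mul_subG.
Qed.

(** Each coset of H has exactly one representative in N, so N acts regularly by translation. *)
Lemma sdprod_normal_regular (gT : finGroupType) (G N H : {group gT}) :
  N ><| H = G -> has_normal_regular G H.
Proof.
move=> defG; have [nsNG sHG NHG nNH tiNH] := sdprod_context defG.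
have sNG := normal_sub nsNG.
have stabG : actperm 'Rs @* G \subset 'N(rcosets H G | 'P).
  by apply/subsetP => _ /morphimP[g _ Gg ->]; apply: translation_stab.
have HNG : H * N = G by rewrite -NHG normC.
have XN Y : Y \in rcosets H G -> exists2 n, n \in N & Y = H :* n.
  move=> /rcosetsP[g]; rewrite -HNG => /mulsgP[h n Hh Nn ->] ->.
  by exists n; rewrite // rcosetM rcoset_id.
exists (restr_perm (rcosets H G) @* (actperm 'Rs @* N))%G; split.
- apply/subsetP => _ /(translations_ofP sNG)[n _ ->].
  by rewrite inE restr_perm_on.
- move=> x y Xx Xy; have [a Na ->] := XN x Xx; have [b Nb ->] := XN y Xy.
  have Xa : H :* a \in rcosets H G.
    by apply/rcosetsP; exists a; rewrite ?(subsetP sNG).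
  have Nab : a^-1 * b \in N by rewrite groupM ?groupV.
  exists (translation G H (a^-1 * b)); split.
    split; first by apply/(translations_ofP sNG); exists (a^-1 * b).
    by rewrite translationE ?(subsetP sNG) // -rcosetM mulKVg.
  move=> _ [/(translations_ofP sNG)[n Nn ->]].
  rewrite translationE ?(subsetP sNG) // -rcosetM => /rcoset_eqP.
  rewrite mem_rcoset => Hanb; congr translation; apply: (mulgI a).
  have : a * n * b^-1 \in N :&: H by rewrite inE Hanb !groupM ?groupV.
  by rewrite tiNH inE -eq_mulgV1 mulKVg => /eqP.
- by do 2!apply: morphim_norms; apply: normal_norm.
by rewrite /translations /= !morphimS.
Qed.

(** This is the action on the cosets of K, whose kernel is the core of K. The point [i0] stands for
    the coset K itself. *)
Lemma coset_perm_rep (gT : finGroupType) (G K : {group gT}) (n : nat) :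
  K \subset G -> #|G : K| = n -> gcore K G = 1 ->
  exists (f : {morphism G >-> {perm 'I_n}}) (i0 : 'I_n),
    'injm f /\ {in G, forall g, f g i0 = i0 -> g \in K}.
Proof.
move=> sKG <- coreK; pose X := rcosets K G.
have XK : K :* 1 \in X by apply/rcosetsP; exists 1; rewrite ?group1.
pose e (i : 'I_#|X|) : {set gT} := enum_val i; pose r := enum_rank_in XK.
have eX i : e i \in X by apply: enum_valP.
have re i : r (e i) = i by apply: enum_valK_in.
have er Y : Y \in X -> e (r Y) = Y by move=> XY; apply: enum_rankK_in.
have Xg g Y : g \in G -> Y \in X -> Y :* g \in X.
  move=> Gg /rcosetsP[x Gx ->]; apply/rcosetsP; exists (x * g); rewrite ?groupM //.
  by rewrite rcosetM.
(* The identity outside G makes [F g] injective for every g, as [perm] requires. *)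
pose F g i := if g \in G then r (e i :* g) else i.
have F_inj g : injective (F g).
  move=> i j; rewrite /F; case: ifP => [Gg /(congr1 e) | //].
  rewrite (er _ (Xg _ _ Gg (eX i))) (er _ (Xg _ _ Gg (eX j))) => eij.
  rewrite -[i]re -[j]re; congr r.
  by rewrite -[e i](rcosetK g) eij rcosetK.
pose f g := perm (@F_inj g).
have fE g i : g \in G -> f g i = r (e i :* g) by move=> Gg; rewrite permE /F Gg.
have fM : {in G &, {morph f : x y / x * y}}.
  move=> x y Gx Gy; apply/permP => i; rewrite permM !fE ?groupM //.
  by rewrite (er _ (Xg _ _ Gx (eX i))) -rcosetM.
have stabE g i : g \in G -> f g i = i -> e i :* g = e i.
  by move=> Gg; rewrite fE // => /(congr1 e); rewrite er ?Xg ?eX.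
exists (Morphism fM), (r (K :* 1)); split; last first.
  move=> g Gg /= /(stabE _ _ Gg); rewrite er // -rcosetM mul1g rcoset1 => eK.
  by have := rcoset_refl K g; rewrite eK.
apply/subsetP => g /morphpreP[Gg]; rewrite inE /= => /eqP fg1; rewrite -coreK.
apply/bigcapP => x Gx; rewrite mem_conjg conjgE invgK mulgA -mem_rcoset.
have Xx : K :* x \in X by apply/rcosetsP; exists x.
have := @stabE g (r (K :* x)) Gg; rewrite fg1 perm1 er // => /(_ erefl) Kxg.
by rewrite -Kxg -rcosetM rcoset_refl.
Qed.

(** * Subgroups of S_5 *)

Lemma odd_permX5 (T : finType) (s : {perm T}) : s ^+ 5 = 1 -> ~~ odd_perm s.
Proof.
move/(congr1 (fun t : {perm T} => odd_perm t)).
by rewrite odd_perm1 !expgS !odd_permM odd_perm1; case: odd_perm.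
Qed.

Lemma card_Alt5 : #|'Alt_('I_5)| = 60.
Proof.
apply/eqP; rewrite -(eqn_pmul2l (isT : 0 < 2)).
by rewrite card_Alt ?card_ord.
Qed.

Lemma card_Sym5 : #|'Sym_('I_5)| = 120.
Proof. by rewrite card_Sym card_ord. Qed.

Lemma der1_Alt5 : ('Alt_('I_5))^`(1) = 'Alt_('I_5).
Proof.
have simA : simple 'Alt_('I_5) by apply: simple_Alt5_base; rewrite card_ord.
have [_ /(_ (('Alt_('I_5))^`(1))%G (der_normal 1 _))[A1 | -> //]] := simpleP _ simA.
have : solvable 'Alt_('I_5).
  by apply: abelian_sol; apply/derG1P.
by rewrite solvable_AltF // card_ord.
Qed.

(* There are at most six 5-Sylow subgroups in S_5, so if S has six of them then
   it contains all of them, and they generate a normal subgroup. *)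
Lemma Sym5_subgroup (S : {group {perm 'I_5}}) : (5 %| #|S|)%N ->
  (exists2 P : {group {perm 'I_5}}, P <| S & #|P| = 5) \/ 'Alt_('I_5) \subset S.
Proof.
move=> S5; pose Sym := 'Sym_('I_5)%G.
have sSS : S \subset Sym by apply/subsetP => x _; rewrite inE.
have S120 : (#|S| %| 120)%N by rewrite -card_Sym5 cardSg.
have logS : logn 5 #|S| = 1%N.
  apply/eqP; rewrite eqn_leq -pfactor_dvdn // ?S5 ?andbT //.
  by have := dvdn_leq_log 5 (isT : (0 < 120)%N) S120.
have nSyl (Q : {group {perm 'I_5}}) : #|'Syl_5(Q)| \in [:: 1; 6]%N.
  have : #|'Syl_5(Q)| \in divisors 120.
    rewrite -dvdn_divisors // (dvdn_trans (card_Syl_dvd 5 Q)) // -card_Sym5.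
    by rewrite cardSg //; apply/subsetP => x _; rewrite inE.
  have /allP all120 :
    all (fun d => (d %% 5 == 1) ==> (d \in [:: 1; 6]))%N (divisors 120) by [].
  by move/all120; rewrite card_Syl_mod.
have [P sylP] := Sylow_exists 5 S.
have P5 : #|P| = 5 by rewrite (card_Hall sylP) p_part logS.
have [n1 | n1] := eqVneq #|'Syl_5(S)| 1%N.
  left; move/eqP/normal_sylowP: n1 => [Q sylQ nsQ]; exists Q => //.
  by rewrite (card_Hall sylQ) p_part logS.
right; have n6 : #|'Syl_5(S)| = 6.
  by have := nSyl S; rewrite !inE (negPf n1) => /eqP.
have eqSyl : 'Syl_5(S) = 'Syl_5(Sym).
  apply/eqP; rewrite eqEcard; apply/andP; split.
    apply/subsetP => Q; rewrite !inE !pHallE => /andP[sQS /eqP->].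
    rewrite (subset_trans sQS) //= !p_part logS card_Sym5.
    by have -> : logn 5 120 = 1%N by [].
  by rewrite n6; have := nSyl Sym; rewrite !inE => /orP[] /eqP->.
pose W := gcore S Sym.
have sPW : P \subset W.
  apply/bigcapsP => x _; rewrite -sub_conjgV.
  have : (P :^ x^-1)%G \in 'Syl_5(Sym).
    rewrite inE pHallE cardJg P5 card_Sym5 p_part.
    by apply/andP; split; first by apply/subsetP => y _; rewrite inE.
  by rewrite -eqSyl inE => /pHall_sub.
have sPA : P \subset 'Alt_('I_5).
  apply/subsetP => s Ps; rewrite Alt_even odd_permX5 //.
  by have := expg_cardG Ps; rewrite P5.
have simA : simple 'Alt_('I_5) by apply: simple_Alt5_base; rewrite card_ord.
have nsWA : W :&: 'Alt_('I_5) <| 'Alt_('I_5).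
  rewrite /normal subsetIr normsI ?normG //.
  by rewrite (subset_trans _ (gcore_norm S Sym)) // Alt_subset.
have [_ /(_ (W :&: 'Alt_('I_5))%G nsWA)] := simpleP _ simA.
case=> [WA1 | WAA]; last by rewrite -WAA subIset // gcore_sub.
have : P \subset W :&: 'Alt_('I_5) by rewrite subsetI sPW.
by rewrite [W :&: _]WA1 subG1 => /eqP P1; move: P5; rewrite P1 cards1.
Qed.

Lemma card_Sym5_over_Alt (S : {group {perm 'I_5}}) : 'Alt_('I_5) \subset S ->
  S :=: 'Alt_('I_5) \/ S :=: 'Sym_('I_5).
Proof.
move=> sAS; have sSS : S \subset 'Sym_('I_5) by apply/subsetP => x _; rewrite inE.
have [d dS] : exists d, (#|S| = d * 60)%N.
  by apply/dvdnP; rewrite -card_Alt5 cardSg.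
have := cardSg sSS; rewrite dS card_Sym5 (@dvdn_pmul2r 60 d 2 isT).
rewrite (dvdn_divisors _ (isT : 0 < 2)) !inE => /orP[] /eqP d1.
  by left; apply/esym/eqP; rewrite eqEcard sAS card_Alt5 dS d1.
by right; apply/eqP; rewrite eqEcard sSS card_Sym5 dS d1.
Qed.

(* The case P ><| K = G covers the solvable transitive groups of degree 5. *)
Lemma degree5_dichotomy (gT : finGroupType) (G K : {group gT}) :
  K \subset G -> #|G : K| = 5 -> gcore K G = 1 ->
  coprime #|K| 5 /\
  ((exists P : {group gT}, P ><| K = G) \/
   60 <= #|G^`(1)| /\ (G \isog 'Alt_('I_5) \/ G \isog 'Sym_('I_5))).
Proof.
move=> sKG iGK coreK; have [f [i0 [injf _]]] := coset_perm_rep sKG iGK coreK.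
have cfG : #|f @* G| = #|G| by rewrite card_injm.
have LG : (#|K| * 5 = #|G|)%N by rewrite -iGK Lagrange.
have G120 : #|G| %| 120.
  by rewrite -cfG -card_Sym5 cardSg //; apply/subsetP => x _; rewrite inE.
have coK : coprime #|K| 5.
  have : #|K| %| 24 by rewrite -(dvdn_pmul2r (isT : 0 < 5)) LG.
  by move/(coprime_dvdl); apply.
split=> //; have [|[Q nsQ Q5] | sAf] := @Sym5_subgroup (f @* G)%G.
- by rewrite /= cfG -LG dvdn_mull.
- left; exists (f @*^-1 Q)%G; have nsPG : f @*^-1 Q <| G.
    rewrite -[X in _ <| X](injmK injf (subxx G)).
    by rewrite morphpre_normal ?(normal_sub nsQ).
  have P5 : #|f @*^-1 Q| = 5.
    by rewrite -(card_injm injf) ?subsetIl // morphpreK // normal_sub.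
  have tiPK : f @*^-1 Q :&: K = 1 by apply: coprime_TIg; rewrite P5 coprime_sym.
  apply/(sdprod_normal_complP nsPG)/complP; split; first by rewrite setIC.
  apply/eqP; rewrite eqEcard mul_subG ?(normal_sub nsPG) //=.
  by rewrite TI_cardMg 1?setIC // P5 LG.
right; split.
  rewrite -(card_injm injf (der_sub 1 G)) morphim_der // -card_Alt5 -der1_Alt5.
  exact/subset_leq_card/dergS.
have isof : G \isog f @* G by apply: sub_isog.
by have [e | e] := card_Sym5_over_Alt sAf; [left | right];
  rewrite -[X in _ \isog X]e.
Qed.

(** A transposition of two points other than [i0] fixes [i0], hence comes from K; being odd, it
    generates a complement of the preimage of A_5. *)
Lemma Sym5_involution_complement (gT : finGroupType) (G K : {group gT}) :
  K \subset G -> #|G : K| = 5 -> gcore K G = 1 -> G \isog 'Sym_('I_5) ->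
  exists t, [/\ t \in K, #[t] = 2 & exists N : {group gT}, N ><| <[t]> = G].
Proof.
move=> sKG iGK coreK isoG.
have [f [i0 [injf stab0]]] := coset_perm_rep sKG iGK coreK.
have G120 : #|G| = 120 by rewrite (card_isog isoG) card_Sym5.
have fG : f @* G = setT.
  apply/eqP; rewrite eqEcard subsetT card_injm // G120.
  by have := card_Sym5; rewrite /= => ->.
have [a [b [a0 b0 ab]]] : exists a b : 'I_5, [/\ a != i0, b != i0 & a != b].
  have := cardsC1 i0; rewrite card_ord => c4.
  have /card_gt1P[a [b [Aa Ab ab]]] : 1 < #|[set~ i0]| by rewrite c4.
  by exists a, b; split=> //; [move: Aa | move: Ab]; rewrite !inE.
have : tperm a b \in f @* G by rewrite fG inE.
case/morphimP=> t _ Gt ft.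
have Kt : t \in K by apply: stab0; rewrite // -ft tpermD.
have ot : #[t] = 2.
  apply: nt_prime_order => //.
    apply: (injmP injf); rewrite ?groupX ?group1 //.
    by rewrite morphX // -ft morph1 expgS expg1 tperm2.
  apply/eqP => t1; move: ft; rewrite t1 morph1 => /permP/(_ a).
  by rewrite tpermL perm1 => /eqP; rewrite eq_sym (negPf ab).
exists t; split=> //; exists (f @*^-1 'Alt_('I_5))%G.
have nsNG : f @*^-1 'Alt_('I_5) <| G.
  rewrite -[X in _ <| X](injmK injf (subxx G)).
  by rewrite morphpre_normal ?fG ?subsetT ?Alt_normal.
have cN : #|f @*^-1 'Alt_('I_5)| = 60.
  by rewrite -(card_injm injf) ?subsetIl // morphpreK ?card_Alt5 // fG subsetT.
have tiN : <[t]> :&: f @*^-1 'Alt_('I_5) = 1.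
  apply: prime_TIg; first by rewrite -orderE ot.
  rewrite cycle_subG; apply/morphpreP => -[_].
  by rewrite -ft Alt_even odd_tperm ab.
apply/(sdprod_normal_complP nsNG)/complP; split=> //.
apply/eqP; rewrite eqEcard mul_subG ?cycle_subG ?(normal_sub nsNG) //=.
by rewrite TI_cardMg // -orderE ot cN G120.
Qed.

Local Close Scope group_scope.
Local Open Scope ring_scope.

(** * From a normal complement to a Hopf Galois structure *)

Section TwistedGroupAlgebra.

(** In the application E is the closure M, [gT] its Galois group, [A] the normal complement N, and
    [pi g] conjugation by the component of g in Gal(M/F). *)
Variables (k : fieldType) (E : fieldExtType k) (gT A : finGroupType).
Variable s : gT -> {lrmorphism E -> E}.
Hypothesis sM : forall a b x, s (a * b)%g x = s b (s a x).
Hypothesis sfix : forall x : E, (forall g, s g x = x) -> exists c : k, x = c%:A.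
Variables (I : finType) (u v : I -> E).
(* With u a basis of E over k, v is its dual basis for the trace form. *)
Hypothesis dualuv : forall g, \sum_i s g (u i) * v i = (g == 1%g)%:R.
Variable pi : gT -> A -> A.
Hypothesis pi1 : forall n, pi 1%g n = n.
Hypothesis piM : forall a b n, pi (a * b)%g n = pi b (pi a n).
Hypothesis piMr : forall g m n, pi g (m * n)%g = (pi g m * pi g n)%g.

Let pi1r g : pi g 1%g = 1%g.
Proof. by apply: (mulIg (pi g 1%g)); rewrite -piMr !mul1g. Qed.

Let piVr g n : pi g n^-1%g = (pi g n)^-1%g.
Proof. by apply: (mulIg (pi g n)); rewrite -piMr !mulVg pi1r. Qed.

Let piK g : cancel (pi g) (pi g^-1%g).
Proof. by move=> n; rewrite -piM mulgV pi1. Qed.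

Let piVK g : cancel (pi g^-1%g) (pi g).
Proof. by move=> n; rewrite -piM mulVg pi1. Qed.

Let pi_bij g : bijective (pi g).
Proof. by exists (pi g^-1%g). Qed.

Let s1 x : s 1%g x = x.
Proof.
by apply: (fmorph_inj (s 1%g)) => /=; rewrite -sM mulg1.
Qed.

(** * The trace form and its dual bases *)

Definition gtrace (x : E) : E := \sum_g s g x.

Lemma gtrace_is_linear : linear gtrace.
Proof.
move=> a x y; rewrite /gtrace scaler_sumr -big_split /=.
by apply: eq_bigr => g _; rewrite linearP.
Qed.
HB.instance Definition _ := GRing.isLinear.Build k E E _ gtrace gtrace_is_linear.

Lemma gtrace_gal g x : s g (gtrace x) = gtrace x.
Proof.
rewrite /gtrace rmorph_sum [RHS](reindex_inj (mulIg g)) /=.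
by apply: eq_bigr => h _; rewrite sM.
Qed.

(** A linear form on E that inverts [c |-> c%:A]; its values matter only on the image of k. *)
Definition kcoef (x : E) : k := coord [tuple (1 : E)] ord0 x.

Lemma kcoef_is_linear : linear (kcoef : E -> k^o).
Proof. by move=> a x y; rewrite /kcoef linearP. Qed.
HB.instance Definition _ :=
  GRing.isLinear.Build k E k^o _ kcoef kcoef_is_linear.

Lemma kcoef_alg c : kcoef c%:A = c.
Proof.
rewrite linearZ /=.
suff -> : kcoef 1 = 1 by rewrite /GRing.scale /= mulr1.
rewrite /kcoef -[X in coord _ _ X]/([tuple (1 : E)]`_(@ord0 0)) coord_free //.
by rewrite seq1_free oner_neq0.
Qed.

Lemma kcoefK x : (forall g, s g x = x) -> (kcoef x)%:A = x.
Proof. by case/sfix=> c ->; rewrite kcoef_alg. Qed.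

Lemma kcoef_trace x : (kcoef (gtrace x))%:A = gtrace x.
Proof. by apply: kcoefK => g; apply: gtrace_gal. Qed.

(** Once the trace is expanded, duality kills every term but the one at g = 1. *)
Lemma dual_trace x : \sum_i gtrace (x * u i) * v i = x.
Proof.
under eq_bigr do rewrite /gtrace mulr_suml.
rewrite exchange_big (bigD1 1%g) //= [X in _ + X]big1 ?addr0 => [|g g1].
  under eq_bigr do rewrite rmorphM /= -mulrA.
  by rewrite -mulr_sumr dualuv eqxx mulr1 s1.
under eq_bigr do rewrite rmorphM /= -mulrA.
by rewrite -mulr_sumr dualuv (negPf g1) mulr0.
Qed.

Lemma trace_nondeg x : (forall y, gtrace (x * y) = 0) -> x = 0.
Proof.
by move=> tx; rewrite -(dual_trace x) big1 // => i _; rewrite tx mul0r.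
Qed.

Lemma dual_orth g h : \sum_i s g (u i) * s h (v i) = (g == h)%:R.
Proof.
have <- : s h (\sum_i s (g * h^-1)%g (u i) * v i) = (g == h)%:R.
  by rewrite dualuv rmorph_nat -eq_mulgV1.
rewrite rmorph_sum; apply: eq_bigr => i _.
by rewrite rmorphM /= -sM mulgKV.
Qed.

(** If the traces of all [u i] vanished, [dual_trace] would give 1 = 0; a nonzero one is scaled to
    1. Such an element normalises the comultiplication. *)
Lemma trace1_exists : exists c, gtrace c = 1.
Proof.
have [i ti | t0] := pickP (fun i => gtrace (u i) != 0).
  exists ((kcoef (gtrace (u i)))^-1 *: u i); rewrite linearZ /=.
  rewrite -kcoef_trace in ti.
  rewrite -[X in _ *: X]kcoef_trace scalerA mulVf ?scale1r //.
  by apply: contraNneq ti => ->; rewrite scale0r.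
have := dual_trace 1; rewrite big1 => [/esym/eqP | i _]; first by rewrite oner_eq0.
by rewrite mul1r; move/negbFE: (t0 i) => /eqP ->; rewrite mul0r.
Qed.

(* The invariants (E[A])^gT, with the convolution reversed, because products of
   Galois automorphisms compose from left to right. *)
Definition tw_defect (f : {ffun A -> E}) : {ffun gT * A -> E} :=
  [ffun x => s x.1 (f x.2) - f (pi x.1 x.2)].

Lemma tw_defect_is_linear : linear tw_defect.
Proof.
move=> a f g; apply/ffunP => x; rewrite !ffunE linearP scalerBr.
by rewrite addrACA opprD.
Qed.
HB.instance Definition _ :=
  GRing.isLinear.Build k _ _ _ tw_defect tw_defect_is_linear.

Definition tw_alg := subvs_of (lker (linfun tw_defect)).
HB.instance Definition _ := Vector.on tw_alg.

Definition ev (n : A) (f : tw_alg) : E := (vsval f : {ffun A -> E}) n.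

Lemma ev_is_linear n : linear (ev n).
Proof. by move=> a f g; rewrite /ev linearP !ffunE. Qed.
HB.instance Definition _ n :=
  GRing.isLinear.Build k tw_alg E _ (ev n) (ev_is_linear n).

Lemma ev_inj f g : (forall n, ev n f = ev n g) -> f = g.
Proof. by move=> fg; apply/val_inj/ffunP => n; apply: fg. Qed.

Lemma ev_pi g n f : ev (pi g n) f = s g (ev n f).
Proof.
have := subvsP f; rewrite memv_ker lfunE => /eqP/ffunP/(_ (g, n)).
by rewrite !ffunE => /eqP; rewrite subr_eq0 => /eqP.
Qed.

(** [vsproj] preserves values only on the subspace, whence the equivariance hypothesis of
    [ev_mktw]. *)
Definition mktw (f : A -> E) : tw_alg := vsproj _ [ffun n => f n].

Lemma ev_mktw (f : A -> E) n :
  (forall g m, f (pi g m) = s g (f m)) -> ev n (mktw f) = f n.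
Proof.
move=> fpi; rewrite /ev vsprojK ?ffunE // memv_ker lfunE.
by apply/eqP/ffunP => -[g m]; rewrite !ffunE fpi subrr.
Qed.

Definition tw_one : tw_alg := mktw (fun n => (n == 1%g)%:R).
Definition tw_mul (f g : tw_alg) : tw_alg :=
  mktw (fun p => \sum_n ev n f * ev (p * n^-1)%g g).

Lemma ev_one n : ev n tw_one = (n == 1%g)%:R.
Proof.
apply: ev_mktw => g m; rewrite rmorph_nat; congr (_%:R); congr (nat_of_bool _).
by rewrite -{1}(pi1r g) (can_eq (piK g)).
Qed.

Lemma ev_mul p f g : ev p (tw_mul f g) = \sum_n ev n f * ev (p * n^-1)%g g.
Proof.
apply: ev_mktw => h m; rewrite rmorph_sum (reindex (pi h)) /=; last exact: onW_bij.
by apply: eq_bigr => n _; rewrite rmorphM /= -!ev_pi piMr piVr.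
Qed.

Lemma tw_mulA : associative tw_mul.
Proof.
move=> f g h; apply: ev_inj => p; rewrite !ev_mul.
under eq_bigr do rewrite ev_mul mulr_sumr.
under [RHS]eq_bigr do rewrite ev_mul mulr_suml.
rewrite [RHS]exchange_big; apply: eq_bigr => n _ /=.
rewrite [RHS](reindex_inj (mulIg n)) /=; apply: eq_bigr => m _.
by rewrite mulgK mulrA invMg mulgA.
Qed.

Lemma tw_mul1l : left_id tw_one tw_mul.
Proof.
move=> f; apply: ev_inj => p; rewrite ev_mul (bigD1 1%g) //= big1 => [|n n1].
  by rewrite ev_one eqxx mul1r invg1 mulg1 addr0.
by rewrite ev_one (negPf n1) mul0r.
Qed.

Lemma tw_mul1r : right_id tw_one tw_mul.
Proof.
move=> f; apply: ev_inj => p; rewrite ev_mul (bigD1 p) //= big1 => [|n n1].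
  by rewrite ev_one mulgV eqxx mulr1 addr0.
by rewrite ev_one -eq_mulgV1 eq_sym (negPf n1) mulr0.
Qed.

Lemma tw_mulDl : left_distributive tw_mul +%R.
Proof.
move=> f g h; apply: ev_inj => p; rewrite linearD /= !ev_mul -big_split /=.
by apply: eq_bigr => n _; rewrite linearD mulrDl.
Qed.

Lemma tw_mulDr : right_distributive tw_mul +%R.
Proof.
move=> f g h; apply: ev_inj => p; rewrite linearD /= !ev_mul -big_split /=.
by apply: eq_bigr => n _; rewrite linearD mulrDr.
Qed.

Lemma tw_one_neq0 : tw_one != 0.
Proof.
apply/eqP => /(congr1 (ev 1%g)) /eqP.
by rewrite linear0 ev_one eqxx oner_eq0.
Qed.

HB.instance Definition _ := GRing.Zmodule_isNzRing.Build tw_alg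
  tw_mulA tw_mul1l tw_mul1r tw_mulDl tw_mulDr tw_one_neq0.

Lemma tw_scaleAl (c : k) (f g : tw_alg) : c *: (f * g) = (c *: f) * g.
Proof.
apply: ev_inj => p; rewrite linearZ /= !ev_mul scaler_sumr.
by apply: eq_bigr => n _; rewrite linearZ /= scalerAl.
Qed.
HB.instance Definition _ := GRing.Lmodule_isLalgebra.Build k tw_alg tw_scaleAl.

Lemma tw_scaleAr (c : k) (f g : tw_alg) : c *: (f * g) = f * (c *: g).
Proof.
apply: ev_inj => p; rewrite linearZ /= !ev_mul scaler_sumr.
by apply: eq_bigr => n _; rewrite linearZ /= scalerAr.
Qed.
HB.instance Definition _ := GRing.Lalgebra_isAlgebra.Build k tw_alg tw_scaleAr.
HB.instance Definition _ := Algebra_isFalgebra.Build k tw_alg.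

Lemma ev1 n : ev n 1 = (n == 1%g)%:R. Proof. exact: ev_one. Qed.
Lemma evM p (f g : tw_alg) : ev p (f * g) = \sum_n ev n f * ev (p * n^-1)%g g.
Proof. exact: ev_mul. Qed.

(* Half of Galois descent: k-independent elements of H are E-independent, since
   applying the trace to a relation over E yields relations over k. *)
Lemma ev_free (a : 'I_(\dim {:tw_alg}) -> E) :
  (forall n, \sum_j a j * ev n (vbasis {:tw_alg})`_j = 0) -> forall j, a j = 0.
Proof.
move=> a0 j; apply: trace_nondeg => y.
have fr : free (vbasis {:tw_alg}) by apply: basis_free (vbasisP _).
suff tr0 : \sum_j kcoef (gtrace (a j * y)) *: (vbasis {:tw_alg})`_j = 0.
  have /freeP/(_ _ tr0 j) t0 := fr.
  by rewrite -kcoef_trace t0 scale0r.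
apply: ev_inj => n; rewrite linear0 linear_sum /=.
transitivity (\sum_g s g y * \sum_i s g (a i) * ev n (vbasis {:tw_alg})`_i).
  under eq_bigr do rewrite linearZ /= -mulr_algl kcoef_trace /gtrace mulr_suml.
  rewrite exchange_big; apply: eq_bigr => g _; rewrite mulr_sumr.
  by apply: eq_bigr => i _; rewrite rmorphM /= mulrCA mulrA.
apply: big1 => g _; suff -> : \sum_i s g (a i) * ev n (vbasis {:tw_alg})`_i = 0.
  by rewrite mulr0.
(* Applying [s g] to the relation at the point [pi g^-1 n] conjugates its coefficients and moves it
   to n. *)
have := congr1 (s g) (a0 (pi g^-1%g n)); rewrite rmorph_sum rmorph0 => e.
rewrite -[RHS]e; apply: eq_bigr => i _.
by rewrite rmorphM /= -ev_pi piVK.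
Qed.

Section EvTensor.
Variables (V : vectType k) (T : Type) (phi : T -> {linear V -> E}).

Definition evt (n : A) (t : T) (x : tensor tw_alg V) : E :=
  tlift (fun a b => ev n a * phi t b) x.

Lemma evt_is_linear n t : linear (evt n t).
Proof. by move=> a x y; apply: tlift_linear. Qed.
HB.instance Definition _ n t :=
  GRing.isLinear.Build k (tensor tw_alg V) E _ (evt n t) (evt_is_linear n t).

Lemma evt_tens n t a b : evt n t (a \ox b) = ev n a * phi t b.
Proof.
rewrite /evt tlift_tens //; split=> [x|y] c z w; rewrite linearP /=.
  by rewrite mulrDr scalerAr.
by rewrite mulrDl scalerAl.
Qed.

Hypothesis phi_inj : forall b, (forall t, phi t b = 0) -> b = 0.

(** For fixed t, [ev_free] separates the first factor; then [phi_inj] separates the second. *)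
Lemma evt_inj x : (forall n t, evt n t x = 0) -> x = 0.
Proof.
move=> x0; apply/matrixP => i j; rewrite mxE.
have fr : free (vbasis {:V}) by apply: basis_free (vbasisP _).
have /freeP := fr; apply; apply: phi_inj => t; rewrite linear_sum /=.
under eq_bigr do rewrite linearZ /=.
pose a i := \sum_j0 (x : 'M_(_, _)) i j0 *: phi t (vbasis {:V})`_j0.
rewrite -/(a i); apply: (@ev_free a) => n; rewrite -[RHS](x0 n t) /evt /tlift.
apply: eq_bigr => l _; rewrite /a mulr_suml; apply: eq_bigr => j0 _.
by rewrite -scalerAl mulrC.
Qed.
End EvTensor.

Notation ev2 := (@evt tw_alg A ev).
Definition ev3 (n : A) (t : A * A) :=
  @evt (tensor tw_alg tw_alg) (A * A)%type (fun t => ev2 t.1 t.2) n t.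
HB.instance Definition _ n t := GRing.Linear.on (ev3 n t).

Lemma ev_eq0 b : (forall t, ev t b = 0) -> b = 0.
Proof. by move=> b0; apply: ev_inj => n; rewrite b0 linear0. Qed.

Lemma ev2_inj x y : (forall n m, ev2 n m x = ev2 n m y) -> x = y.
Proof.
move=> xy; apply/eqP; rewrite -subr_eq0; apply/eqP/(evt_inj ev_eq0) => n m.
by rewrite linearB /= xy subrr.
Qed.

Lemma ev3_inj x y : (forall n t, ev3 n t x = ev3 n t y) -> x = y.
Proof.
move=> xy; apply/eqP; rewrite -subr_eq0; apply/eqP.
apply: (@evt_inj _ _ (fun t : A * A => ev2 t.1 t.2)).
  by move=> b b0; apply: ev2_inj => n m; rewrite (b0 (n, m)) linear0.
by move=> n t; rewrite linearB; apply/eqP; rewrite subr_eq0; apply/eqP/xy.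
Qed.

Lemma tlift_ev2 (W : lmodType k) (phi : {linear W -> E})
    (f : tw_alg -> tw_alg -> W) (c : A -> A -> E) x :
  (forall a b, phi (f a b) = \sum_n \sum_m ev n a * ev m b * c n m) ->
  phi (tlift f x) = \sum_n \sum_m ev2 n m x * c n m.
Proof.
move=> phif; rewrite /evt /tlift linear_sum.
transitivity (\sum_n \sum_m \sum_i \sum_j (x : 'M_(_, _)) i j *:
     (ev n (vbasis {:tw_alg})`_i * ev m (vbasis {:tw_alg})`_j * c n m)); last first.
  apply: eq_bigr => n _; apply: eq_bigr => m _; rewrite mulr_suml.
  apply: eq_bigr => i _; rewrite mulr_suml; apply: eq_bigr => j _.
  by rewrite -scalerAl.
under [RHS]eq_bigr do rewrite exchange_big.
rewrite [RHS]exchange_big; apply: eq_bigr => i _; rewrite linear_sum /=.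
under [RHS]eq_bigr do rewrite exchange_big.
rewrite [RHS]exchange_big; apply: eq_bigr => j _ /=.
rewrite linearZ /= phif scaler_sumr; apply: eq_bigr => n _.
by rewrite scaler_sumr.
Qed.

(** The trace over [gT] of the function with value x at n and 0 elsewhere. *)
Definition tw_orb (x : E) (n : A) : tw_alg :=
  mktw (fun m => \sum_(g | pi g n == m) s g x).

Lemma ev_orb m x n : ev m (tw_orb x n) = \sum_(g | pi g n == m) s g x.
Proof.
apply: ev_mktw => h p; rewrite rmorph_sum (reindex_inj (mulIg h)) /=.
by apply: eq_big => [g|g _]; rewrite ?piM ?(can_eq (piK h)) ?sM.
Qed.

(** At g = 1 this writes the indicator of n as an E-combination of elements of H, the other half of
    Galois descent. *)
Lemma ev_orb_dual g m n :
  \sum_i s g (v i) * ev m (tw_orb (u i) n) = (pi g n == m)%:R.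
Proof.
transitivity (\sum_(h | pi h n == m) \sum_i s h (u i) * s g (v i)).
  rewrite exchange_big; apply: eq_bigr => i _; rewrite ev_orb mulr_sumr.
  by apply: eq_bigr => h _; rewrite mulrC.
under eq_bigr do rewrite dual_orth.
have [gn | gn] := boolP (pi g n == m).
  by rewrite (bigD1 g) //= eqxx big1 ?addr0 // => h /andP[_ /negPf->].
by rewrite big1 // => h hn; case: (h =P g) hn => // ->; rewrite (negPf gn).
Qed.

(** * The Hopf algebra structure *)

Variable c : E.
Hypothesis trc : gtrace c = 1.

(* Delta h is meant to have values (p, q) |-> [p = q] h(p).  Since the indicator
   of n is the sum of the v_i * tw_orb (u_i) n, and h is the sum of the
   tw_orb (c * h n) n, this element of H (x) H has that property. *)
Definition tw_comul (h : tw_alg) : tensor tw_alg tw_alg :=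
  \sum_n \sum_i \sum_j kcoef (gtrace (c * ev n h * (v i * v j))) *:
    (tw_orb (u i) n \ox tw_orb (u j) n).

Lemma tw_comul_is_linear : linear tw_comul.
Proof.
move=> a x y; rewrite /tw_comul scaler_sumr -big_split; apply: eq_bigr => n _.
rewrite scaler_sumr -big_split; apply: eq_bigr => i _.
rewrite scaler_sumr -big_split; apply: eq_bigr => j _ /=.
by rewrite linearP mulrDr mulrDl -scalerAr -scalerAl !linearP scalerDl scalerA.
Qed.
HB.instance Definition _ :=
  GRing.isLinear.Build k _ _ _ tw_comul tw_comul_is_linear.

Lemma ev2_comul p q h : ev2 p q (tw_comul h) = (p == q)%:R * ev p h.
Proof.
(* With the trace expanded over g, the sums over i and j are instances of [ev_orb_dual] and leave
   two indicators. *)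
transitivity (\sum_n \sum_g (pi g n == p)%:R * (pi g n == q)%:R * s g (c * ev n h)).
  rewrite linear_sum; apply: eq_bigr => n _; rewrite linear_sum /=.
  under [RHS]eq_bigr do rewrite -!ev_orb_dual -mulrA mulr_suml.
  rewrite [RHS]exchange_big; apply: eq_bigr => i _; rewrite linear_sum /=.
  under [RHS]eq_bigr do rewrite mulr_suml mulr_sumr.
  rewrite [RHS]exchange_big; apply: eq_bigr => j _ /=.
  rewrite linearZ /= evt_tens -mulr_algl kcoef_trace /gtrace mulr_suml.
  apply: eq_bigr => g _; rewrite !(rmorphM (s g)) /=.
  by ring.
rewrite exchange_big /=.
transitivity (\sum_g (p == q)%:R * (s g c * ev p h)); last first.
  by rewrite -mulr_sumr -mulr_suml -/(gtrace c) trc mul1r.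
apply: eq_bigr => g _; rewrite (bigD1 (pi g^-1%g p)) //= big1 => [|n np].
  by rewrite piVK eqxx mul1r rmorphM /= -ev_pi piVK addr0.
by rewrite (can2_eq (piK g) (piVK g)) (negPf np) !mul0r.
Qed.

(** Delta h is supported on the diagonal, so only [d n n] survives. The identities below reduce to
    naming the kernel d of each map. *)
Lemma tlift_comul (W : lmodType k) (phi : {linear W -> E})
    (f : tw_alg -> tw_alg -> W) (d : A -> A -> E) h :
  (forall a b, phi (f a b) = \sum_n \sum_m ev n a * ev m b * d n m) ->
  phi (tlift f (tw_comul h)) = \sum_n ev n h * d n n.
Proof.
move/tlift_ev2 => ->; apply: eq_bigr => n _; rewrite (bigD1 n) //= big1 => [|m mn].
  by rewrite ev2_comul eqxx mul1r addr0.
by rewrite ev2_comul eq_sym (negPf mn) !mul0r.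
Qed.

Definition tw_counit (h : tw_alg) : k := kcoef (\sum_n ev n h).

Lemma tw_counit_is_linear : linear (tw_counit : tw_alg -> k^o).
Proof.
move=> a x y; rewrite /tw_counit -linearP /= scaler_sumr -big_split.
by congr kcoef; apply: eq_bigr => n _; rewrite linearP.
Qed.
HB.instance Definition _ :=
  GRing.isLinear.Build k tw_alg k^o _ tw_counit tw_counit_is_linear.

Lemma tw_counitE h : (tw_counit h)%:A = \sum_n ev n h.
Proof.
apply: kcoefK => g; rewrite rmorph_sum [RHS](reindex (pi g)) /=;
  last exact: onW_bij.
by apply: eq_bigr => n _; rewrite ev_pi.
Qed.

Definition tw_antipode (h : tw_alg) : tw_alg := mktw (fun n => ev n^-1%g h).

Lemma ev_antipode n h : ev n (tw_antipode h) = ev n^-1%g h.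
Proof. by apply: ev_mktw => g m; rewrite -piVr ev_pi. Qed.

Lemma tw_antipode_is_linear : linear tw_antipode.
Proof.
move=> a x y; apply: ev_inj => n.
by rewrite linearP /= !ev_antipode linearP.
Qed.
HB.instance Definition _ :=
  GRing.isLinear.Build k _ _ _ tw_antipode tw_antipode_is_linear.

Lemma sum_delta (F : A -> E) p : \sum_n F n * (n == p)%:R = F p.
Proof.
rewrite (bigD1 p) //= eqxx mulr1 big1 ?addr0 // => n /negPf->.
by rewrite mulr0.
Qed.

Lemma ev_delta a p : ev p a = \sum_n ev n a * (n == p)%:R.
Proof. by rewrite sum_delta. Qed.

Lemma sum_delta2 (F G : A -> E) p q :
  \sum_n \sum_m F n * G m * ((n == p)%:R * (m == q)%:R) = F p * G q.
Proof.
rewrite -(sum_delta F) -(sum_delta G) mulr_suml; apply: eq_bigr => n _.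
by rewrite mulr_sumr; apply: eq_bigr => m _; rewrite mulrACA.
Qed.

Lemma tw_comulA h :
  tlift (fun a b => tlift (fun a1 a2 => a1 \ox (a2 \ox b)) (tw_comul a))
        (tw_comul h)
  = tlift (fun a b => a \ox tw_comul b) (tw_comul h).
Proof.
apply: ev3_inj => p [q r].
(* At (p, q, r) both sides equal the value of h at p if p = q = r, and 0 otherwise. *)
rewrite (@tlift_comul _ _ _ (fun n m => (p == q)%:R * ((n == p)%:R * (m == r)%:R))).
  rewrite (@tlift_comul _ _ _ (fun n m => (q == r)%:R * ((n == p)%:R * (m == q)%:R))).
    apply: eq_bigr => n _; congr (_ * _).
    case: (n =P p) => [->|_]; last by rewrite !mul0r !mulr0.
    by case: (p =P q) => [->|_]; rewrite !mul1r ?mulr1 ?mulr0 ?mul0r.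
  move=> a b; rewrite /= /ev3 evt_tens /= ev2_comul.
  rewrite mulrCA -(sum_delta2 (ev^~ a) (ev^~ b)) mulr_sumr; apply: eq_bigr => n _.
  by rewrite mulr_sumr; apply: eq_bigr => m _; rewrite mulrCA.
move=> a b; rewrite (@tlift_comul _ _ _
  (fun n m => (n == p)%:R * (m == q)%:R * ev r b)).
  transitivity ((p == q)%:R * (ev p a * ev r b)).
    transitivity (\sum_n ev n a * ((n == q)%:R * ev r b) * (n == p)%:R).
      by apply: eq_bigr => n _; ring.
    by rewrite sum_delta mulrCA.
  rewrite -(sum_delta2 (ev^~ a) (ev^~ b)) mulr_sumr; apply: eq_bigr => n _.
  by rewrite mulr_sumr; apply: eq_bigr => m _; rewrite mulrCA.
move=> a1 a2; rewrite /= /ev3 evt_tens /= evt_tens mulrA.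
rewrite -(sum_delta2 (ev^~ a1) (ev^~ a2)) mulr_suml.
apply: eq_bigr => n _; rewrite mulr_suml; apply: eq_bigr => m _.
by rewrite -mulrA.
Qed.

Lemma tw_counitl h : tlift (fun a b => tw_counit a *: b) (tw_comul h) = h.
Proof.
apply: ev_inj => p; rewrite (@tlift_comul _ _ _ (fun _ m => (m == p)%:R)).
  by rewrite -ev_delta.
move=> a b; rewrite linearZ /= -mulr_algl tw_counitE mulr_suml.
apply: eq_bigr => n _; rewrite (ev_delta b) mulr_sumr.
by apply: eq_bigr => m _; rewrite mulrA.
Qed.

Lemma tw_counitr h : tlift (fun a b => tw_counit b *: a) (tw_comul h) = h.
Proof.
apply: ev_inj => p; rewrite (@tlift_comul _ _ _ (fun n _ => (n == p)%:R)).
  by rewrite -ev_delta.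
move=> a b; rewrite linearZ /= -mulr_algl tw_counitE mulrC (ev_delta a) mulr_suml.
apply: eq_bigr => n _; rewrite mulr_sumr; apply: eq_bigr => m _.
by rewrite mulrAC.
Qed.

Lemma tw_comul1 : tw_comul 1 = 1 \ox 1.
Proof.
apply: ev2_inj => p q; rewrite ev2_comul evt_tens /= !ev1.
by case: (p =P 1%g) => [->|_]; rewrite ?mulr0 ?mul0r // mulr1 mul1r eq_sym.
Qed.

Lemma ev_mul_swap p (f g : tw_alg) :
  ev p (f * g) = \sum_l ev l g * ev (l^-1 * p)%g f.
Proof.
have inj : injective (fun l => l^-1 * p)%g by move=> x y /mulIg/invg_inj.
rewrite evM (reindex_inj inj); apply: eq_bigr => l _ /=.
by rewrite mulrC invMg invgK mulKVg.
Qed.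

Lemma tw_comulM a b : tw_comul (a * b) =
  tlift (fun a1 a2 => tlift (fun b1 b2 => (a1 * b1) \ox (a2 * b2)) (tw_comul b))
        (tw_comul a).
Proof.
have div_swap (n l p : A) : (n == l^-1 * p)%g = (l == p * n^-1)%g.
  by apply/eqP/eqP=> ->; rewrite invMg invgK (mulKVg, mulgKV).
apply: ev2_inj => p q; rewrite ev2_comul evM.
(* The kernel says p = l n and q = l m, with l the argument of b; on the diagonal n = m this forces
   p = q. *)
rewrite (@tlift_comul _ _ _ (fun n m => \sum_l ev l b *
  ((n == l^-1 * p)%g%:R * (m == l^-1 * q)%g%:R))).
  rewrite mulr_sumr; apply: eq_bigr => n _; rewrite mulrCA; congr (_ * _).
  under eq_bigr do rewrite !div_swap mulrA mulrAC.
  rewrite sum_delta mulrC; congr (_ * _).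
  by rewrite (inj_eq (mulIg _)).
move=> a1 a2; rewrite (@tlift_comul _ _ _
  (fun l m => ev (l^-1 * p)%g a1 * ev (m^-1 * q)%g a2)).
  under [RHS]eq_bigr do under eq_bigr do rewrite mulr_sumr.
  under [RHS]eq_bigr do rewrite exchange_big.
  rewrite [RHS]exchange_big; apply: eq_bigr => l _ /=.
  rewrite -(sum_delta2 (ev^~ a1) (ev^~ a2)) mulr_sumr.
  apply: eq_bigr => n _; rewrite mulr_sumr; apply: eq_bigr => m _.
  by rewrite mulrCA.
move=> b1 b2; rewrite /= evt_tens /= !ev_mul_swap mulr_suml.
apply: eq_bigr => n _; rewrite mulr_sumr; apply: eq_bigr => m _.
by rewrite mulrACA.
Qed.

Lemma tw_counit1 : tw_counit 1 = 1.
Proof.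
rewrite /tw_counit -[RHS]kcoef_alg scale1r; congr kcoef.
by rewrite -(sum_delta (fun=> 1) 1%g); apply: eq_bigr => n _; rewrite ev1 mul1r.
Qed.

Lemma alg_inj (x y : k) : x%:A = y%:A :> E -> x = y.
Proof. by move/(congr1 kcoef); rewrite !kcoef_alg. Qed.

Lemma tw_counitM a b : tw_counit (a * b) = tw_counit a * tw_counit b.
Proof.
apply: alg_inj; transitivity ((tw_counit a)%:A * (tw_counit b)%:A : E).
  rewrite !tw_counitE mulr_suml.
  under eq_bigr do rewrite evM.
  rewrite exchange_big; apply: eq_bigr => n _; rewrite -mulr_sumr; congr (_ * _).
  by rewrite [RHS](reindex_inj (mulIg n^-1%g)).
by rewrite mulr_algl scalerA.
Qed.

Lemma tw_antipodel h :
  tlift (fun a b => tw_antipode a * b) (tw_comul h) = (tw_counit h)%:A.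
Proof.
apply: ev_inj => p; rewrite linearZ /= ev1 -mulr_algl tw_counitE.
rewrite (@tlift_comul _ _ _ (fun n m => (m == p * n)%g%:R)).
  rewrite mulr_suml; apply: eq_bigr => n _; congr (_ * _%:R); congr nat_of_bool.
  by rewrite -{1}[n]mul1g (inj_eq (mulIg _)) eq_sym.
move=> a b; rewrite /= evM (reindex_inj invg_inj); apply: eq_bigr => n _.
rewrite ev_antipode invgK (ev_delta b) mulr_sumr; apply: eq_bigr => m _.
by rewrite mulrA.
Qed.

Lemma tw_antipoder h :
  tlift (fun a b => a * tw_antipode b) (tw_comul h) = (tw_counit h)%:A.
Proof.
apply: ev_inj => p; rewrite linearZ /= ev1 -mulr_algl tw_counitE.
rewrite (@tlift_comul _ _ _ (fun n m => (m == n * p^-1)%g%:R)).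
  rewrite mulr_suml; apply: eq_bigr => n _; congr (_ * _%:R); congr nat_of_bool.
  by rewrite -{1}[n]mulg1 (inj_eq (mulgI _)) eq_sym -eq_invg1 invgK.
move=> a b; rewrite /= evM; apply: eq_bigr => n _.
rewrite ev_antipode invMg invgK (ev_delta b) mulr_sumr; apply: eq_bigr => m _.
by rewrite mulrA.
Qed.

Definition tw_hopf : finHopfAlgebra k :=
  FinHopfAlgebra tw_comulA tw_counitl tw_counitr tw_comul1 tw_comulM tw_counit1
    tw_counitM tw_antipodel tw_antipoder.

Lemma tw_cocommutative : cocommutative tw_hopf.
Proof.
move=> h; apply: ev2_inj => p q; rewrite ev2_comul.
rewrite (@tlift_comul _ _ _ (fun n m => (m == p)%:R * (n == q)%:R)).
  under eq_bigr do rewrite mulrA.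
  rewrite sum_delta mulrC eq_sym; case: eqP => [->|_] //.
  by rewrite !mul0r.
move=> a b; rewrite /= evt_tens /= mulrC -(sum_delta2 (ev^~ a) (ev^~ b)).
by do 2!apply: eq_bigr => ? _; congr (_ * _); rewrite mulrC.
Qed.

(** The matrix of values of a basis has independent rows by [ev_free] and full row space by
    [ev_orb_dual], so it is square. *)
Lemma dim_tw_alg : \dim {:tw_alg} = #|A|.
Proof.
pose M : 'M[E]_(\dim {:tw_alg}, #|A|) :=
  \matrix_(j, l) ev (enum_val l) (vbasis {:tw_alg})`_j.
have rfree : row_free M.
  apply: inj_row_free => a aM; apply/rowP => j; rewrite mxE.
  apply: (@ev_free (a 0)) => n; have /rowP/(_ (enum_rank n)) := aM.
  rewrite !mxE => e; rewrite -[RHS]e; apply: eq_bigr => l _.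
  by rewrite mxE enum_rankK.
have rfull : row_full M.
  apply/row_fullP; exists (\matrix_(l, j) \sum_i
    v i * (coord (vbasis {:tw_alg}) j (tw_orb (u i) (enum_val l)))%:A).
  apply/matrixP => l m; rewrite !mxE -(inj_eq enum_val_inj).
  rewrite -[X in X == _]pi1 -(ev_orb_dual 1%g).
  under eq_bigr do rewrite mxE mulr_suml.
  rewrite exchange_big; apply: eq_bigr => i _ /=; rewrite s1.
  rewrite [in RHS](coord_vbasis (memvf (tw_orb (u i) (enum_val l)))).
  rewrite linear_sum mulr_sumr; apply: eq_bigr => j _.
  by rewrite [M _ _]mxE linearZ /= -mulrA mulr_algl.
by rewrite -(eqP rfree) (eqP rfull).
Qed.

(** * The action on F and the Galois map *)

Variables (F : fieldExtType k) (iota : {lrmorphism F -> E}).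
Variables (Gs : {group gT}) (eps : A -> gT).
Hypothesis epsM : forall m n, eps (m * n)%g = (eps m * eps n)%g.
Hypothesis pi_eps : forall m n, pi (eps n) m = m.
Hypothesis iota_fix : forall g t, g \in Gs -> s g (iota t) = iota t.
Hypothesis iota_onto :
  forall x, {in Gs, forall g, s g x = x} -> exists t, x = iota t.
Hypothesis pi_conj : forall g n, g \in Gs -> eps (pi g n) = (eps n ^ g)%g.
Hypothesis eps_Gs : forall g n, g \in Gs -> (g * eps n)%g = 1%g -> n = 1%g.
Hypothesis dimF : \dim {:F} = #|A|.

Definition tw_act0 (f : tw_alg) (t : F) : E := \sum_n ev n f * s (eps n) (iota t).

(** An element g of [Gs] fixes [iota t] and permutes the terms by [pi g], which [eps] turns into
    conjugation by g; so the sum is fixed by [Gs]. *)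
Lemma tw_act0_iota f t : exists t', tw_act0 f t = iota t'.
Proof.
apply: iota_onto => g Gg; rewrite rmorph_sum [RHS](reindex (pi g)) /=;
  last exact: onW_bij.
apply: eq_bigr => n _; rewrite rmorphM /= -ev_pi; congr (_ * _).
by rewrite pi_conj // -sM conjgC sM iota_fix.
Qed.

Definition tw_act_fun (f : tw_alg) (t : F) : F := (linfun iota)^-1%VF (tw_act0 f t).

Lemma iota_act f t : iota (tw_act_fun f t) = tw_act0 f t.
Proof.
have -> : iota (tw_act_fun f t) = linfun iota (tw_act_fun f t) by rewrite lfunE.
rewrite limg_lfunVK //; have [t' ->] := tw_act0_iota f t.
by rewrite -[iota t'](lfunE iota) memv_img ?memvf.
Qed.

Let iota_inj : injective iota. Proof. exact: fmorph_inj. Qed.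

Lemma tw_act_fun_is_linear f : linear (tw_act_fun f).
Proof.
move=> a x y; rewrite /tw_act_fun -linearP; congr (_ _).
rewrite /tw_act0 scaler_sumr -big_split; apply: eq_bigr => n _ /=.
by rewrite !linearP /= mulrDr scalerAr.
Qed.
HB.instance Definition _ f :=
  GRing.isLinear.Build k F F _ (tw_act_fun f) (tw_act_fun_is_linear f).

Definition tw_act (f : tw_alg) : 'End(F) := linfun (tw_act_fun f).

Lemma tw_act_is_linear : linear tw_act.
Proof.
move=> a f g; apply/lfunP => t; rewrite add_lfunE scale_lfunE !lfunE /=.
apply: iota_inj; rewrite linearP /= !iota_act /tw_act0 scaler_sumr -big_split.
by apply: eq_bigr => n _; rewrite linearP /= mulrDl scalerAl.
Qed.
HB.instance Definition _ :=
  GRing.isLinear.Build k tw_alg 'End(F) _ tw_act tw_act_is_linear.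

Lemma iota_tw_act f t : iota (tw_act f t) = \sum_n ev n f * s (eps n) (iota t).
Proof. by rewrite lfunE iota_act. Qed.

Let eps1 : eps 1%g = 1%g.
Proof. by apply: (mulIg (eps 1%g)); rewrite -epsM !mul1g. Qed.

Lemma tw_module_algebra : module_algebra (H := tw_hopf) tw_act.
Proof.
split=> [t | a b t | h | h x y]; apply: iota_inj; rewrite !iota_tw_act.
- rewrite (bigD1 1%g) //= big1 ?addr0 => [|n n1]; last first.
    by rewrite ev1 (negPf n1) mul0r.
  by rewrite ev1 eqxx mul1r eps1 s1.
(* N acts trivially on itself, so [s (eps n)] fixes the values of b, and the reversed convolution
   matches the reversed composition of automorphisms. *)
- under eq_bigr do rewrite evM mulr_suml.
  rewrite exchange_big; apply: eq_bigr => n _; rewrite rmorph_sum mulr_sumr.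
  rewrite (reindex_inj (mulIg n)); apply: eq_bigr => m _ /=.
  by rewrite mulgK rmorphM /= -ev_pi pi_eps -sM epsM mulrA.
- rewrite linearZ /= rmorph1 tw_counitE; apply: eq_bigr => n _.
  by rewrite !rmorph1 mulr1.
rewrite (@tlift_comul _ _ _ (fun n m => s (eps n) (iota x) * s (eps m) (iota y))).
  by apply: eq_bigr => n _; rewrite !rmorphM.
move=> a b; rewrite /= rmorphM /= !iota_tw_act mulr_suml.
by apply: eq_bigr => n _; rewrite mulr_sumr; apply: eq_bigr => m _; rewrite mulrACA.
Qed.

(** The embeddings [s (eps n) \o iota] are distinct by [eps_Gs]; the traces [w i] of the [u i] down
    to F, paired with the [v i], form a dual system separating them. *)
Lemma eps_free (y : A -> E) :
  (forall t, \sum_n y n * s (eps n) (iota t) = 0) -> forall n, y n = 0.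
Proof.
move=> y0 m.
pose w i := \sum_(g in Gs) s g (u i).
have wF i : exists t, w i = iota t.
  apply: iota_onto => g Gg; rewrite rmorph_sum (reindex_inj (mulIg g^-1%g)) /=.
  apply: eq_big => [h|h _]; first by rewrite groupMr ?groupV.
  by rewrite -sM mulgKV.
have wd n : \sum_i s (eps n) (w i) * s (eps m) (v i) = (n == m)%:R.
  transitivity (\sum_(g in Gs) (g * (eps n * (eps m)^-1) == 1)%g%:R : E).
    under eq_bigr do rewrite rmorph_sum mulr_suml.
    rewrite exchange_big; apply: eq_bigr => g _ /=.
    under eq_bigr do rewrite -sM.
    by rewrite dual_orth mulgA -eq_mulgV1.
  have epsV : ((eps m)^-1 = eps m^-1)%g.
    by apply: (mulIg (eps m)); rewrite -epsM !mulVg eps1.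
  rewrite epsV -epsM; have [->|nm] := eqVneq n m.
    rewrite mulgV eps1 (bigD1 1%g) ?group1 //= mul1g eqxx big1 ?addr0 // => g.
    by case/andP=> _ /negPf; rewrite mulg1 => ->.
  apply: big1 => g Gg; case: eqP => // /eps_Gs -/(_ Gg)/eqP.
  by rewrite -eq_mulgV1 (negPf nm).
rewrite -(sum_delta y m); transitivity (\sum_i 0 * s (eps m) (v i)); last first.
  by apply: big1 => i _; rewrite mul0r.
transitivity (\sum_i (\sum_n y n * s (eps n) (w i)) * s (eps m) (v i)).
  under eq_bigr do rewrite -wd mulr_sumr.
  rewrite exchange_big; apply: eq_bigr => i _; rewrite mulr_suml.
  by apply: eq_bigr => n _; rewrite mulrA.
by apply: eq_bigr => i _; have [t ->] := wF i; rewrite y0.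
Qed.

(** [eps_free] removes the sum over n, [ev_free] the sum over the basis of H, and freeness of the
    basis of F the rest. *)
Lemma tw_galois_map_inj x :
  hopf_galois_map (H := tw_hopf) tw_act x = 0 -> x = 0.
Proof.
move=> jx0; pose z b := \sum_a (x : 'M_(_, _)) a b *: (vbasis {:F})`_a.
have z0 b : iota (z b) = 0.
  move: b; apply: ev_free => n; move: n; apply: eps_free => t.
  have /(congr1 iota) := congr1 (fun f : 'End(F) => f t) jx0.
  rewrite zero_lfunE rmorph0 => e; rewrite -[RHS]e /hopf_galois_map /tlift.
  rewrite sum_lfunE rmorph_sum /=.
  under [RHS]eq_bigr do rewrite sum_lfunE rmorph_sum /=.
  rewrite [RHS]exchange_big /=.
  under eq_bigr do rewrite mulr_suml.
  rewrite exchange_big; apply: eq_bigr => b _ /=.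
  under eq_bigr do rewrite -mulrA.
  rewrite -mulr_sumr -iota_tw_act -rmorphM /z mulr_suml rmorph_sum.
  apply: eq_bigr => a _; rewrite scale_lfunE comp_lfunE.
  by rewrite [amull _ _]lfunE /= scalerAl.
apply/matrixP => a b; rewrite mxE.
have fr : free (vbasis {:F}) by apply: basis_free (vbasisP _).
have /freeP/(_ (fun a => (x : 'M_(_, _)) a b)) := fr; apply.
by apply: iota_inj; rewrite rmorph0 z0.
Qed.

Lemma tw_hopf_galois : hopf_galois F.
Proof.
exists tw_hopf, tw_act; split; first exact: tw_cocommutative.
  exact: tw_module_algebra.
have j_lin : linear (hopf_galois_map (H := tw_hopf) tw_act).
  by move=> a x y; apply: tlift_linear.
pose jL := GRing.isLinear.Build k _ _ _ _ j_lin.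
pose J : {linear tensor F tw_hopf -> 'End(F)} :=
  HB.pack (hopf_galois_map (H := tw_hopf) tw_act) jL.
(* Injectivity suffices, as H and F both have dimension [#|A|]. *)
have kerJ : lker (linfun J) == 0%VS.
  rewrite -subv0; apply/subvP => x; rewrite memv_ker memv0 lfunE /= => /eqP Jx.
  by apply/eqP/tw_galois_map_inj.
have imJ : limg (linfun J) = fullv.
  apply/eqP; rewrite eqEdim subvf limg_dim_eq ?(eqP kerJ) ?capv0 //=.
  by rewrite !dimvf dim_matrix [X in (X <= _)%N]/dim /= -!dimvf dim_tw_alg dimF.
exists (linfun J)^-1%VF => x.
  by have := lker0_lfunK kerJ x; rewrite [linfun J x]lfunE.
have := limg_lfunVK (f := linfun J) (x := x); rewrite imJ memvf => /(_ isT).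
by rewrite lfunE.
Qed.

End TwistedGroupAlgebra.

Lemma vsval1 (k : fieldType) (L : fieldExtType k) (M : {subfield L}) :
  vsval (1 : subvs_of M) = 1.
Proof. exact: algid1. Qed.

(** * Galois automorphisms as maps of M *)

Section GaloisAction.

Variables (k : fieldType) (L : splittingFieldType k) (M : {subfield L}).

Definition gal_sub (g : gal_of M) (x : subvs_of M) : subvs_of M :=
  vsproj M (g (vsval x)).

Lemma gal_subE g x : vsval (gal_sub g x) = g (vsval x).
Proof. by rewrite vsprojK ?memv_gal ?subvsP. Qed.

Lemma gal_sub_is_linear g : linear (gal_sub g).
Proof. by move=> a x y; apply: val_inj; rewrite /= !(gal_subE, linearP). Qed.
HB.instance Definition _ g :=
  GRing.isLinear.Build k _ _ _ (gal_sub g) (gal_sub_is_linear g).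

Lemma gal_sub_is_monoid_morphism g : monoid_morphism (gal_sub g).
Proof.
split=> [|x y]; apply: val_inj; rewrite [LHS]gal_subE.
  by rewrite [in LHS]vsval1 rmorph1 [RHS]vsval1.
by rewrite [RHS]/= !gal_subE -rmorphM.
Qed.
HB.instance Definition _ g :=
  GRing.isMonoidMorphism.Build _ _ (gal_sub g) (gal_sub_is_monoid_morphism g).

Lemma gal_subM g h x : gal_sub (g * h)%g x = gal_sub h (gal_sub g x).
Proof. by apply: val_inj; rewrite /= !gal_subE galM ?subvsP. Qed.

Lemma mem_gal1 g : g \in 'Gal(M / 1)%g.
Proof. by rewrite gal_kHom ?sub1v // k1AHom. Qed.

(** By [gal_matrix] the conjugates of suitable [w j] form an invertible matrix; the column of its
    inverse at g = 1 is the dual family. *)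
Lemma gal_sub_dual : exists u v : 'I_#|'Gal(M / 1)%g| -> subvs_of M,
  forall g, \sum_i gal_sub g (u i) * v i = (g == 1%g)%:R.
Proof.
have [w [wM _] [uM _ _]] := gal_matrix 'Gal(M / 1)%g.
pose W := \matrix_(i, j < #|'Gal(M / 1)%g|)
  gal_sub (enum_val i) (vsproj M (tnth w j)).
have uW : W \in unitmx.
  rewrite -(map_unitmx (vsval : {rmorphism subvs_of M -> L})).
  congr (_ \in unitmx): uM; apply/matrixP => i j.
  by rewrite !mxE /= gal_subE vsprojK ?wM ?mem_tnth.
pose r (g : gal_of M) := enum_rank_in (mem_gal1 1%g) g.
exists (fun j => vsproj M (tnth w j)), (fun j => invmx W j (r 1%g)) => g.
have /matrixP/(_ (r g) (r 1%g)) := mulmxV uW; rewrite !mxE.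
have rK h : enum_val (r h) = h by rewrite enum_rankK_in ?mem_gal1.
rewrite -(inj_eq enum_val_inj) !rK => <-; apply: eq_bigr => j _.
by rewrite mxE rK.
Qed.

Section Inclusion.
Variable F : {subfield L}.

Definition incl_sub (x : subvs_of F) : subvs_of M := vsproj M (vsval x).

Lemma incl_sub_is_linear : linear incl_sub.
Proof. by move=> a x y; rewrite /incl_sub !linearP. Qed.
HB.instance Definition _ :=
  GRing.isLinear.Build k _ _ _ incl_sub incl_sub_is_linear.

Hypothesis sFM : (F <= M)%VS.

Lemma incl_subE x : vsval (incl_sub x) = vsval x.
Proof. by rewrite vsprojK // (subvP sFM) ?subvsP. Qed.

Lemma incl_sub_is_monoid_morphism : monoid_morphism incl_sub.
Proof.
split=> [|x y]; apply: val_inj; rewrite [LHS]incl_subE.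
  by rewrite [LHS]vsval1 [RHS]vsval1.
by rewrite [RHS]/= !incl_subE.
Qed.

Definition incl_lrmorphism : {lrmorphism subvs_of F -> subvs_of M} :=
  HB.pack incl_sub
    (GRing.isMonoidMorphism.Build _ _ incl_sub incl_sub_is_monoid_morphism).

End Inclusion.
End GaloisAction.

Lemma sdprod_hopf_galois (k : fieldType) (L : splittingFieldType k)
    (F M : {subfield L}) (N : {group gal_of M}) :
  (F <= M)%VS -> galois 1 M -> (N ><| 'Gal(M / F) = 'Gal(M / 1))%g ->
  hopf_galois (subvs_of F).
Proof.
move=> sFM galM1 defG; set H := 'Gal(M / F)%G in defG *.
have [nsNG _ NHG nNH tiNH] := sdprod_context defG.
have galMF : galois F M by apply: galoisS galM1; rewrite sub1v.
have [u [v uv]] := gal_sub_dual M.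
pose s g : {lrmorphism subvs_of M -> subvs_of M} := gal_sub g.
have sfix (x : subvs_of M) : (forall g, s g x = x) -> exists c : k, x = c%:A.
  move=> sx; have : vsval x \in fixedField 'Gal(M / 1)%g.
    by apply/fixedFieldP => [|g _]; rewrite ?subvsP // -gal_subE [gal_sub g x]sx.
  rewrite (galois_fixedField galM1) => /vlineP[c xc]; exists c.
  by apply: val_inj; rewrite /= xc algid1.
(* The component of g in H. Conjugating by it instead of g makes N act trivially on itself. *)
pose h g := remgr N H g.
have hH g : h g \in H by apply: mem_remgr; rewrite NHG mem_gal1.
have hM a b : h (a * b)%g = (h a * h b)%g.
  by apply: (remgrM _ nsNG); rewrite ?mem_gal1 ?(sdprod_compl defG).
pose pi (g : gal_of M) (n : [subg N]) : [subg N] := subg N (sgval n ^ h g)%g.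
have piE g n : sgval (pi g n) = (sgval n ^ h g)%g.
  by apply: subgK; rewrite memJ_norm ?subgP // (subsetP nNH).
have sM a b x : s (a * b)%g x = s b (s a x) by apply: gal_subM.
have [c trc] := trace1_exists sM sfix uv.
apply: (@tw_hopf_galois _ _ _ [subg N] s sM sfix _ u v uv pi _ _ _ c trc
  _ (incl_lrmorphism sFM) H (@sgval _ N)) => //.
- by move=> n; apply: subg_inj; rewrite piE /h remgr1 ?group1 // conjg1.
- by move=> a b n; apply: subg_inj; rewrite !piE hM conjgM.
- by move=> g m n; apply: subg_inj; rewrite /= !piE conjMg.
- by move=> m n; apply: subg_inj; rewrite piE /h remgr1 ?subgP // conjg1.
- move=> g t Hg; apply: val_inj; rewrite /= gal_subE incl_subE //.
  by rewrite (fixed_gal sFM Hg) ?subvsP.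
- move=> x Hx; have : vsval x \in fixedField H.
    apply/fixedFieldP => [|g Hg]; first exact: subvsP.
    by rewrite -gal_subE [gal_sub g x]Hx.
  rewrite (galois_fixedField galMF) => Fx; exists (Subvs Fx).
  by apply: val_inj; rewrite /= incl_subE.
- by move=> g n Hg; rewrite piE /h (remgr_id tiNH).
- move=> g n Hg /eqP; rewrite -eq_invg_mul => /eqP gn.
  have : sgval n \in N :&: H by rewrite inE subgP -gn groupV.
  by rewrite tiNH inE => /eqP n1; apply: subg_inj.
rewrite dimvf -[dim _]/(\dim F) card_sub.
have dimM : \dim M = #|'Gal(M / 1)%g| by rewrite -galois_dim // dimv1 divn1.
have := sdprod_card defG; rewrite -dimM -(galois_dim galMF).
rewrite -[X in _ = X -> _](divnK (field_dimS sFM)) mulnC => /eqP.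
rewrite eqn_pmul2l => [/eqP<- //|]; by rewrite divn_gt0 ?adim_gt0 ?dimvS.
Qed.

(** * From a Hopf Galois structure to a regular subgroup *)

Section GrouplikeOperators.

Variables (k : fieldType) (F E : fieldExtType k) (gT : finGroupType).
Variable s : gT -> {lrmorphism E -> E}.
Hypothesis sM : forall a b x, s (a * b)%g x = s b (s a x).
Variable iota : {lrmorphism F -> E}.
Hypothesis s_ext : forall phi : F -> E, linear phi -> phi 1 = 1 ->
  {morph phi : x y / x * y} -> exists g, forall t, phi t = s g (iota t).
Variables (H : finHopfAlgebra k) (act : {linear H -> 'End(F)}).
Hypothesis Hact : module_algebra act.
Hypothesis Hbij : bijective (hopf_galois_map act).

Local Notation d := (\dim {:H}).
Local Notation hb i := ((vbasis {:H})`_i).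
Local Notation fb j := ((vbasis {:F})`_j).

Let fb_free : free (vbasis {:F}). Proof. exact: basis_free (vbasisP _). Qed.

Lemma hopf_galois_map_expand (x : tensor F H) t : hopf_galois_map act x t =
  \sum_q (\sum_p (x : 'M_(_, _)) p q *: fb p) * act (hb q) t.
Proof.
rewrite /hopf_galois_map /tlift sum_lfunE.
under eq_bigr do rewrite sum_lfunE.
rewrite exchange_big; apply: eq_bigr => q _; rewrite mulr_suml.
apply: eq_bigr => p _; rewrite scale_lfunE comp_lfunE [amull _ _]lfunE /=.
by rewrite scalerAl.
Qed.

Definition act_mx : 'M[F]_(d, \dim {:F}) := \matrix_(i, j) act (hb i) (fb j).

(** A relation between the rows over F is a tensor killed by the Galois map, which is injective. *)
Lemma act_mx_free : row_free act_mx.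
Proof.
apply: inj_row_free => a aA.
pose x : tensor F H := \matrix_(p, q) coord (vbasis {:F}) p (a 0 q).
have xq q : \sum_p (x : 'M_(_, _)) p q *: fb p = a 0 q.
  rewrite [RHS](coord_vbasis (memvf _)); apply: eq_bigr => p _.
  by rewrite mxE.
have jx0 : hopf_galois_map act x = hopf_galois_map act 0.
  apply/lfunP => t; rewrite !hopf_galois_map_expand.
  rewrite [RHS]big1 => [|q _]; last first.
    by rewrite big1 ?mul0r // => p _; rewrite mxE scale0r.
  rewrite (coord_vbasis (memvf t)); under eq_bigr do rewrite linear_sum mulr_sumr.
  rewrite exchange_big big1 // => j _ /=.
  have /rowP/(_ j) := aA; rewrite !mxE => aAj.
  transitivity (coord (vbasis {:F}) j t *: \sum_q a 0 q * act_mx q j); last first.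
    by rewrite aAj scaler0.
  rewrite scaler_sumr.
  by apply: eq_bigr => q _; rewrite linearZ /= -scalerAr xq mxE.
have x0 := bij_inj Hbij jx0; apply/rowP => q; rewrite -xq x0 mxE.
by apply: big1 => p _; rewrite mxE scale0r.
Qed.

(** The Galois map is onto: preimages of the coordinate forms of F, seen as endomorphisms, express
    the unit rows. *)
Lemma act_mx_full : row_full act_mx.
Proof.
rewrite -sub1mx; apply/row_subP => i.
have [j' _ jK'] := Hbij.
pose w := row i (1%:M : 'M[F]_(\dim {:F})).
have phi_lin : linear (fun t : F => \sum_j coord (vbasis {:F}) j t *: w 0 j).
  move=> c x y; rewrite scaler_sumr -big_split; apply: eq_bigr => j _ /=.
  by rewrite linearP scalerDl scalerA.
pose phiL := GRing.isLinear.Build k _ _ _ _ phi_lin.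
pose phi : {linear F -> F} :=
  HB.pack (fun t : F => \sum_j coord (vbasis {:F}) j t *: w 0 j) phiL.
pose x := j' (linfun phi).
apply/submxP; exists (\row_q \sum_p (x : 'M_(_, _)) p q *: fb p).
apply/rowP => j; rewrite -/w; transitivity (phi (fb j)).
  rewrite /= (bigD1 j) //= big1 => [|j0 j0j].
    by rewrite coord_free // eqxx scale1r addr0.
  by rewrite coord_free // ?(negPf j0j) 1?eq_sym ?(negPf j0j) scale0r.
rewrite -[phi _](lfunE phi) -[linfun phi]jK' hopf_galois_map_expand mxE.
by apply: eq_bigr => q _; rewrite !mxE.
Qed.

(* For v in E (x) H, written in the basis of H, and rho = s g \o iota:
   the map sending t to the sum of the v_i * rho (h_i t). *)
Definition twist (v : 'rV[E]_d) (g : gT) (t : F) : E :=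
  \sum_i v 0 i * s g (iota (act (hb i) t)).

Lemma twist_is_linear v g : linear (twist v g).
Proof.
move=> a x y; rewrite /twist scaler_sumr -big_split; apply: eq_bigr => i _ /=.
by rewrite !linearP mulrDr /= scalerAr.
Qed.
HB.instance Definition _ v g :=
  GRing.isLinear.Build k F E _ (twist v g) (twist_is_linear v g).

Lemma twist_mx v g (j : 'I_(\dim {:F})) :
  twist v g (fb j) = (v *m map_mx (s g \o iota) act_mx) 0 j.
Proof. by rewrite mxE; apply: eq_bigr => i _; rewrite !mxE. Qed.

Lemma twist_eq0 v g : (forall t, twist v g t = 0) -> v = 0.
Proof.
move=> v0; apply/eqP.
have fr : row_free (map_mx (s g \o iota) act_mx).
  by rewrite row_free_map act_mx_free.
by rewrite -(mulmx_free_eq0 v fr); apply/eqP/rowP => j; rewrite -twist_mx v0 mxE.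
Qed.

Lemma twist_inj v w g : twist v g =1 twist w g -> v = w.
Proof.
move=> vw; apply/eqP; rewrite -subr_eq0; apply/eqP/(@twist_eq0 _ g) => t.
rewrite /twist; under eq_bigr do rewrite !mxE mulrBl.
by rewrite sumrB; apply/eqP; rewrite subr_eq0; apply/eqP/vw.
Qed.

(** The element of E (x) H that corresponds to the embedding [s h \o iota] in Hom_k(F, E); [pinvmx]
    solves the system because the matrix is full. *)
Definition theta (h : gT) : 'rV[E]_d :=
  (\row_j s h (iota (fb j))) *m pinvmx (map_mx (s 1%g \o iota) act_mx).

Lemma twist_theta1 h t : twist (theta h) 1%g t = s h (iota t).
Proof.
rewrite (coord_vbasis (memvf t)) !linear_sum; apply: eq_bigr => j _.
rewrite !linearZ /=; congr (_ *: _); rewrite twist_mx mulmxKpV ?mxE //.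
by rewrite submx_full // row_full_map act_mx_full.
Qed.

Let bil (Z : 'I_d -> 'I_d -> E) g x y :=
  \sum_p \sum_q Z p q * (s g (iota (act (hb p) x)) * s g (iota (act (hb q) y))).

(** [twist_eq0], used once in each variable, embeds E (x) H (x) H into the bilinear maps from F to
    E. *)
Let bil_eq0 Z g : (forall x y, bil Z g x y = 0) -> forall p q, Z p q = 0.
Proof.
move=> Z0 p q.
have /rowP/(_ q) : \row_q Z p q = 0; last by rewrite !mxE.
apply: (@twist_eq0 _ g) => y.
have /rowP/(_ p) : \row_p twist (\row_q Z p q) g y = 0.
  apply: (@twist_eq0 _ g) => x; rewrite -[RHS](Z0 x y); apply: eq_bigr => i _.
  rewrite mxE mulr_suml; apply: eq_bigr => j _.
  by rewrite mxE -mulrA [X in _ * X]mulrC.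
by rewrite !mxE.
Qed.

Lemma twistM v g x y : twist v g (x * y) =
  bil (fun p q => \sum_i v 0 i * ((comul H (hb i) : 'M_(_, _)) p q)%:A) g x y.
Proof.
have [_ _ _ actM] := Hact.
transitivity (\sum_i \sum_p \sum_q v 0 i * ((comul H (hb i) : 'M_(_, _)) p q *:
    (s g (iota (act (hb p) x)) * s g (iota (act (hb q) y))))).
  apply: eq_bigr => i _; rewrite actM /tlift !linear_sum mulr_sumr.
  apply: eq_bigr => p _; rewrite !linear_sum mulr_sumr; apply: eq_bigr => q _.
  by rewrite !linearZ /= !rmorphM.
rewrite exchange_big; apply: eq_bigr => p _ /=.
rewrite exchange_big; apply: eq_bigr => q _ /=.
rewrite mulr_suml; apply: eq_bigr => i _.
by rewrite -mulrA mulr_algl.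
Qed.

Lemma mul_twist v g x y : twist v g x * twist v g y =
  bil (fun p q => v 0 p * v 0 q) g x y.
Proof.
rewrite mulr_suml; apply: eq_bigr => p _; rewrite mulr_sumr.
by apply: eq_bigr => q _; rewrite mulrACA.
Qed.

(* theta h is grouplike: Delta (theta h) and theta h (x) theta h act in the same
   way on F (x) F through iota, hence are equal, hence act in the same way through
   every other embedding. *)
Lemma twist_theta_ext g h : exists r, forall t, twist (theta h) g t = s r (iota t).
Proof.
apply: s_ext => [||x y]; first exact: twist_is_linear.
  have [_ _ act1 _] := Hact; transitivity (twist (theta h) 1%g 1).
    by apply: eq_bigr => i _; rewrite act1 !linearZ /= !rmorph1.
  by rewrite twist_theta1 !rmorph1.
rewrite twistM mul_twist; set Z1 := fun p q => _; set Z2 := fun p q => _.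
suff ZZ p q : Z1 p q = Z2 p q by do 2!apply: eq_bigr => ? _; rewrite ZZ.
apply/eqP; rewrite -subr_eq0; apply/eqP; move: p q.
apply: (@bil_eq0 (fun p q => Z1 p q - Z2 p q) 1%g) => x' y'.
have /eqP : bil Z1 1%g x' y' = bil Z2 1%g x' y'.
  by rewrite -twistM -mul_twist !twist_theta1 !rmorphM.
rewrite -subr_eq0 => /eqP e; rewrite -[RHS]e /bil -sumrB; apply: eq_bigr => p _.
by rewrite -sumrB; apply: eq_bigr => q _; rewrite mulrBl.
Qed.

(** In the application, g and h lie in the same right coset of Gal(M/F). Testing on a basis makes
    the relation boolean. *)
Definition same_restr g h :=
  [forall j : 'I_(\dim {:F}), s g (iota (fb j)) == s h (iota (fb j))].

Lemma same_restrP g h :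
  reflect (forall t, s g (iota t) = s h (iota t)) (same_restr g h).
Proof.
apply: (iffP forallP) => [gh t | gh j]; last by rewrite gh.
rewrite (coord_vbasis (memvf t)) !linear_sum; apply: eq_bigr => j _.
by rewrite !linearZ /= (eqP (gh j)).
Qed.

Let cop_ex g h :
  exists r, [forall j : 'I_(\dim {:F}), twist (theta h) g (fb j) == s r (iota (fb j))].
Proof.
by have [r e] := twist_theta_ext g h; exists r; apply/forallP => j; rewrite e.
Qed.

(** The embedding obtained from that of g by [theta h], through a chosen representative; it is
    canonical only up to [same_restr]. *)
Definition cop g h : gT := xchoose (cop_ex g h).

Lemma copE g h t : twist (theta h) g t = s (cop g h) (iota t).
Proof.
have /forallP e := xchooseP (cop_ex g h).
rewrite (coord_vbasis (memvf t)) !linear_sum; apply: eq_bigr => j _.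
by rewrite !linearZ /= (eqP (e j)).
Qed.

Lemma theta_eq h h' : same_restr h h' -> theta h = theta h'.
Proof.
by move/same_restrP=> hh'; apply: (@twist_inj _ _ 1%g) => t; rewrite !twist_theta1.
Qed.

Lemma theta_uniq v h : (forall t, twist v 1%g t = s h (iota t)) -> v = theta h.
Proof. by move=> e; apply: (@twist_inj _ _ 1%g) => t; rewrite e twist_theta1. Qed.

(** The unit of H acts as the identity at every embedding, so by uniqueness it is [theta 1]. *)
Lemma copg1 g : same_restr (cop g 1%g) g.
Proof.
have [act1 _ _ _] := Hact.
pose one := \row_i (coord (vbasis {:H}) i 1)%:A : 'rV[E]_d.
have oneE r t : twist one r t = s r (iota t).
  rewrite -{2}[t]act1 (coord_vbasis (memvf (1 : H))) linear_sum sum_lfunE !linear_sum.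
  apply: eq_bigr => i _; rewrite mxE mulr_algl.
  by rewrite linearZ scale_lfunE !linearZ.
by apply/same_restrP => t; rewrite -copE -(theta_uniq (oneE 1%g)) oneE.
Qed.

Lemma cop_same g g' h h' :
  same_restr g g' -> same_restr h h' -> same_restr (cop g h) (cop g' h').
Proof.
move=> /same_restrP gg' /theta_eq hh'; apply/same_restrP => t.
by rewrite -!copE hh'; apply: eq_bigr => i _; rewrite gg'.
Qed.

Lemma cop_inj g h h' : same_restr (cop g h) (cop g h') -> same_restr h h'.
Proof.
move/same_restrP => e; apply/same_restrP => t; rewrite -!twist_theta1.
by congr (twist _ _ _); apply: (@twist_inj _ _ g) => x; rewrite !copE.
Qed.

(** The factors of H are swapped: expanding an embedding through w puts the action of [hb j] outside
    that of [hb i]. *)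
Let vmul (v w : 'rV[E]_d) : 'rV[E]_d :=
  \row_l \sum_i \sum_j v 0 i * w 0 j * (coord (vbasis {:H}) l (hb j * hb i))%:A.

Let twist_vmul v w g r : (forall t, twist w g t = s r (iota t)) ->
  twist v r =1 twist (vmul v w) g.
Proof.
have [_ actA _ _] := Hact; move=> wr t.
transitivity (\sum_i \sum_j v 0 i * w 0 j * s g (iota (act (hb j * hb i) t))).
  apply: eq_bigr => i _; rewrite -wr mulr_sumr; apply: eq_bigr => j _.
  by rewrite actA mulrA.
rewrite /twist; under [RHS]eq_bigr do rewrite mxE mulr_suml.
rewrite [RHS]exchange_big; apply: eq_bigr => i _ /=.
under [RHS]eq_bigr do rewrite mulr_suml.
rewrite [RHS]exchange_big; apply: eq_bigr => j _ /=.
rewrite [in LHS](coord_vbasis (memvf (hb j * hb i))) linear_sum sum_lfunE !linear_sum.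
rewrite mulr_sumr; apply: eq_bigr => l _; rewrite -[RHS]mulrA mulr_algl.
by rewrite linearZ scale_lfunE !linearZ.
Qed.

(* theta h' * theta h and theta (cop h h') have the same action at rho = iota. *)
Lemma copA g h h' : same_restr (cop (cop g h) h') (cop g (cop h h')).
Proof.
have e : vmul (theta h') (theta h) = theta (cop h h').
  apply: theta_uniq => t; rewrite -(twist_vmul _ (r := h)) ?copE //.
  exact: twist_theta1.
by apply/same_restrP => t; rewrite -!copE -e; apply: twist_vmul; apply: copE.
Qed.

(** Applying c to the coefficients of [theta h] gives some [theta h'], with h' read off at 1 = c^-1
    * c. This makes translations normalise the regular group. *)
Lemma cop_gal h c : exists h', forall g, same_restr (cop g h * c)%g (cop (g * c)%g h').
Proof.
have sc g t : s c (twist (theta h) g t) = twist (map_mx (s c) (theta h)) (g * c)%g t.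
  rewrite rmorph_sum; apply: eq_bigr => i _.
  by rewrite [map_mx _ _ _ _]mxE rmorphM /= sM.
exists (cop c^-1%g h * c)%g => g; apply/same_restrP => t.
rewrite sM -!copE sc; congr (twist _ _ _); apply: theta_uniq => x.
by rewrite -[1%g](mulVg c) -sc copE sM.
Qed.

End GrouplikeOperators.

Local Open Scope group_scope.

(** * A regular group from a product of cosets *)

Section RegularFromCosetProduct.

Variables (gT : finGroupType) (H : {group gT}) (m : gT -> gT -> gT).
Hypothesis mg1 : forall g, H :* m g 1 = H :* g.
Hypothesis m_same : forall g g' h h',
  H :* g = H :* g' -> H :* h = H :* h' -> H :* m g h = H :* m g' h'.
Hypothesis m_inj : forall g h h', H :* m g h = H :* m g h' -> H :* h = H :* h'.
Hypothesis mA : forall g h h', H :* m (m g h) h' = H :* m g (m h h').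
Hypothesis m_gal : forall h c, exists h', forall g,
  H :* (m g h * c) = H :* m (g * c) h'.

Local Notation X := (rcosets H [set: gT]).

Let XP Y : reflect (exists g, Y = H :* g) (Y \in X).
Proof.
by apply: (iffP rcosetsP) => [[g _ ->] | [g ->]]; exists g; rewrite ?inE.
Qed.

Let mX g : H :* g \in X. Proof. by apply/XP; exists g. Qed.

Let m_onto g r : exists h, H :* m g h = H :* r.
Proof.
pose f (Y : {set gT}) := H :* m g (repr Y).
have fX : f @: X \subset X by apply/subsetP => _ /imsetP[Y _ ->]; apply: mX.
have f_inj : {in X &, injective f}.
  move=> _ _ /XP[h ->] /XP[h' ->] /m_inj.
  by rewrite !rcoset_repr.
have /eqP fX' : f @: X == X by rewrite eqEcard fX (card_in_imset f_inj) leqnn.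
have : H :* r \in f @: X by rewrite fX' mX.
by case/imsetP=> Y _ ->; exists (repr Y).
Qed.

Let f h (Y : {set gT}) := if Y \in X then H :* m (repr Y) h else Y.

Let fE h g : f h (H :* g) = H :* m g h.
Proof. by rewrite /f mX; apply: m_same; rewrite ?rcoset_repr. Qed.

Let f_inj h : injective (f h).
Proof.
(* A right inverse h' of h, available by finiteness, provides the inverse map. *)
have [h' hh'] := m_onto h 1.
apply: (can_inj (g := f h')) => Y; have [/XP[g ->] | nX] := boolP (Y \in X).
  by rewrite !fE mA (m_same (erefl (H :* g)) hh') mg1.
by rewrite /f (negPf nX) (negPf nX).
Qed.

Let p h := perm (@f_inj h).

Let pE h g : p h (H :* g) = H :* m g h.
Proof. by rewrite permE fE. Qed.

Let p_on h : p h \in perm.Sym X.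
Proof.
rewrite inE; apply/subsetP => Y; rewrite inE permE /f.
by case: ifP => // _; rewrite eqxx.
Qed.

Let perm_eqX q q' : q \in perm.Sym X -> q' \in perm.Sym X ->
  (forall g, q (H :* g) = q' (H :* g)) -> q = q'.
Proof.
rewrite !inE => qX q'X e; apply/permP => Y.
have [/XP[g ->] // | nX] := boolP (Y \in X).
by rewrite (out_perm qX) // (out_perm q'X).
Qed.

Let N := [set p h | h : gT].

Let N_group : group_set N.
Proof.
apply/group_setP; split.
  apply/imsetP; exists 1 => //; apply: perm_eqX => [||g]; rewrite ?group1 ?p_on //.
  by rewrite perm1 pE mg1.
move=> _ _ /imsetP[h _ ->] /imsetP[h' _ ->]; apply/imsetP; exists (m h h') => //.
by apply: perm_eqX => [||g]; rewrite ?groupM ?p_on // permM !pE mA.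
Qed.

(** The right multiplications form a group by [mA], are sharply transitive by [m_onto] and [m_inj],
    and are normalised by translations by [m_gal]. *)
Lemma regular_from_coset_product : exists N : {group {perm {set gT}}},
  [/\ N \subset perm.Sym X, sharply_transitive N X
    & translations [set: gT]%G H \subset 'N(N)].
Proof.
exists (Group N_group); split.
- by apply/subsetP => _ /imsetP[h _ ->]; apply: p_on.
- move=> _ _ /XP[g ->] /XP[r ->]; have [h hr] := m_onto g r.
  exists (p h); split; first by rewrite imset_f // pE.
  move=> _ [/imsetP[h' _ ->]]; rewrite pE -hr => /m_inj hh'.
  by apply: perm_eqX => [||g']; rewrite ?p_on // !pE; apply: m_same.
apply/subsetP => t /translationsE[c _ [tX tE]].
rewrite inE; apply/subsetP => _ /imsetP[_ /imsetP[h _ ->] ->].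
have [h' hh'] := m_gal h c; apply/imsetP; exists h' => //.
apply: perm_eqX => [||g]; rewrite ?groupJ ?p_on //.
have -> : H :* g = t (H :* (g * c^-1)) by rewrite tE // -rcosetM mulgKV.
by rewrite permJ pE !tE ?mX // -!rcosetM pE hh'.
Qed.

End RegularFromCosetProduct.

Lemma hopf_galois_regular (k : fieldType) (L : splittingFieldType k)
    (F M : {subfield L}) :
  (F <= M)%VS -> galois 1 M -> hopf_galois (subvs_of F) ->
  exists N : {group {perm {set gal_of M}}},
    [/\ N \subset perm.Sym (rcosets 'Gal(M / F) 'Gal(M / 1)),
        sharply_transitive N (rcosets 'Gal(M / F) 'Gal(M / 1))
      & translations 'Gal(M / 1)%G 'Gal(M / F)%G \subset 'N(N)].
Proof.
move=> sFM galM1 [H [act [_ Hact Hbij]]].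
have -> : 'Gal(M / 1)%G = [set: gal_of M]%G.
  by apply/val_inj/setP => g; rewrite mem_gal1 inE.
have -> : 'Gal(M / 1) = [set: gal_of M] by apply/setP => g; rewrite mem_gal1 inE.
have [_ _ nM1] := and3P galM1.
pose s g : {lrmorphism subvs_of M -> subvs_of M} := gal_sub g.
pose iota := incl_lrmorphism sFM.
have s_ext (phi : subvs_of F -> subvs_of M) : linear phi -> phi 1%R = 1%R ->
    {morph phi : x y / (x * y)%R} -> exists g, forall t, phi t = s g (iota t).
  move=> phi_lin phi1 phiM.
  pose phiL : {linear subvs_of F -> subvs_of M} := 
    HB.pack phi (GRing.isLinear.Build k _ _ _ phi phi_lin).
  (* Projecting onto F first extends phi linearly to L; [kHom] asks for multiplicativity on F
     only. *)
  pose f : 'End(L) := linfun (vsval \o phiL \o vsproj F).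
  have fE x : f x = vsval (phi (vsproj F x)) by rewrite lfunE.
  have homf : kHom 1 F f.
    apply/kHomP_tmp; split=> [_ /vlineP[c ->] | x y Fx Fy].
      rewrite linearZ /=; congr (_ *: _)%R; rewrite fE.
      have -> : vsproj F 1%R = 1%R by apply: val_inj; rewrite /= vsprojK ?mem1v ?algid1.
      by rewrite phi1 vsval1.
    rewrite !fE; have -> : (vsproj F (x * y) = vsproj F x * vsproj F y)%R.
      by apply: val_inj; rewrite /= !vsprojK ?rpredM.
    by rewrite phiM.
  have [|g _ fg] := kHom_to_gal _ nM1 homf; first by rewrite sub1v.
  exists g => t; apply: val_inj; rewrite [RHS]gal_subE incl_subE //.
  by rewrite -fg ?subvsP // fE vsvalK.
have sM a b x : s (a * b) x = s b (s a x) by apply: gal_subM.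
have sameP g h : reflect ('Gal(M / F) :* g = 'Gal(M / F) :* h) (same_restr s iota g h).
  apply: (iffP (same_restrP s iota g h)) => [e | e t].
    apply/rcoset_eqP; rewrite mem_rcoset gal_kHom //; apply/kHomP_tmp.
    split=> [x Fx | x y _ _]; last by rewrite rmorphM.
    have Mx := subvP sFM x Fx; rewrite galM //.
    have /(congr1 vsval) := e (Subvs Fx); rewrite !gal_subE !incl_subE //= => ->.
    by rewrite -galM // mulgV gal_id.
  have /rcosetP[a Ha ->] : g \in 'Gal(M / F) :* h by rewrite -e rcoset_refl.
  apply: val_inj; rewrite [LHS]gal_subE [RHS]gal_subE incl_subE //.
  by rewrite galM ?(subvP sFM) ?subvsP // (fixed_gal sFM Ha) ?subvsP.
have cg1 := copg1 s_ext Hact Hbij.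
have c_same := @cop_same _ _ _ _ _ _ s_ext _ _ Hact Hbij.
have c_inj := @cop_inj _ _ _ _ _ _ s_ext _ _ Hact Hbij.
have cA := copA s_ext Hact Hbij; have c_gal := cop_gal sM s_ext Hact Hbij.
move: (cop _ _ _) cg1 c_same c_inj cA c_gal => m cg1 c_same c_inj cA c_gal.
apply: (@regular_from_coset_product _ _ m) => [g | g g' h h' | g h h' | g h h' | h c].
- exact: (sameP _ _ (cg1 g)).
- by move=> /sameP e /sameP e'; apply: (sameP _ _ (c_same _ _ _ _ e e')).
- by move=> /sameP e; apply: (sameP _ _ (c_inj _ _ _ e)).
- exact: (sameP _ _ (cA g h h')).
have [h' e] := c_gal h c; exists h' => g; exact: (sameP _ _ (e g)).
Qed.

Local Close Scope group_scope.
Local Close Scope ring_scope.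

(** * Degree five *)

Lemma gal_self (k : fieldType) (L : splittingFieldType k) (M : {subfield L}) :
  'Gal(M / M)%g = 1%g.
Proof.
apply/trivgP/subsetP => x Gx; rewrite inE; apply/gal_eqP => a Ma.
by rewrite gal_id (fixed_gal (subvv M) Gx).
Qed.

(** The core is normal, so its fixed field is Galois over k and contains K; by minimality it
    contains M. *)
Lemma galois_closure_gcore (k : fieldType) (L : splittingFieldType k)
    (K M : {subfield L}) :
  galois_closure K M -> gcore 'Gal(M / K)%g 'Gal(M / 1)%g = 1%g.
Proof.
case=> sKM galM minM; pose C := gcore_group 'Gal(M / K)%G 'Gal(M / 1)%G.
have sC : C \subset 'Gal(M / K)%g by apply: gcore_sub.
have nsC : (C <| 'Gal(M / 1))%g by apply: gcore_normal; rewrite galS ?sub1v.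
have galMK : galois K M by apply: galoisS galM; rewrite sub1v.
have sKC : (K <= fixedField C)%VS.
  by rewrite -(galois_fixedField galMK) fixedFieldS.
have := minM _ sKC (normal_fixedField_galois galM nsC).
by move/(galS M); rewrite gal_fixedField gal_self => /trivgP.
Qed.

Lemma dim_gal_index (k : fieldType) (L : splittingFieldType k)
    (F M : {subfield L}) :
  (F <= M)%VS -> galois 1 M -> \dim F = #|'Gal(M / 1) : 'Gal(M / F)|%g.
Proof.
move=> sFM galM; have galMF : galois F M by apply: galoisS galM; rewrite sub1v.
have sG : 'Gal(M / F)%g \subset 'Gal(M / 1)%g by rewrite galS ?sub1v.
by rewrite -(dim_fixed_galois galM sG) (galois_fixedField galMF) dimv1 divn1.
Qed.

Lemma card_sharply_transitive (T : finType) (X : {set T}) (N : {group {perm T}}) x :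
  N \subset perm.Sym X -> sharply_transitive N X -> x \in X -> #|N| = #|X|.
Proof.
move=> sNX trN Xx.
have NX s : s \in N -> s x \in X.
  move=> Ns; have := subsetP sNX s Ns; rewrite inE => sX.
  by rewrite (perm_closed x sX).
have -> : X = [set (s : {perm T}) x | s in N].
  apply/setP => y; apply/idP/imsetP => [Xy | [s Ns ->]]; last exact: NX.
  by have [s [[Ns sx] _]] := trN x y Xx Xy; exists s.
rewrite card_in_imset // => s s' Ns Ns' e.
have [n [_ un]] := trN x (s x) Xx (NX s Ns).
by rewrite -(un s) ?(un s').
Qed.

Lemma hopf_galois_degree_ge60 (k : fieldType) (L : splittingFieldType k)
    (K M F : {subfield L}) :
  galois_closure K M -> \dim K = 5 -> coprime #|'Gal(M / K)%g| 5 ->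
  #|'Gal(M / K)%g| %| 24 -> 60 <= #|'Gal(M / 1)^`(1)|%g ->
  hopf_galois_between K M F -> 60 <= \dim F.
Proof.
move=> closK degK coK K24 der60 [sKF sFM /(hopf_galois_regular sFM)].
have [sKM galM _] := closK; case/(_ galM) => N [sNX trN nNT].
have sFK : 'Gal(M / F)%g \subset 'Gal(M / K)%g by apply: galS.
have sK1 : 'Gal(M / K)%g \subset 'Gal(M / 1)%g by rewrite galS ?sub1v.
have iK : #|'Gal(M / 1) : 'Gal(M / K)|%g = 5 by rewrite -(dim_gal_index sKM).
rewrite leqNgt; apply/negP => ltF.
have cN : #|N| = \dim F.
  have XF : ('Gal(M / F) :* 1 \in rcosets 'Gal(M / F) 'Gal(M / 1))%g.
    by apply/rcosetsP; exists 1%g; rewrite ?group1.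
  by rewrite (card_sharply_transitive sNX trN XF) (dim_gal_index sFM).
have dF : \dim F = (5 * #|'Gal(M / K) : 'Gal(M / F)|%g)%N.
  by rewrite (dim_gal_index sFM) // -(Lagrange_index sK1 sFK) iK.
have [P chP P5] : exists2 P : {group _}, (P \char N)%g & #|P| = 5.
  (* The index of Gal(M/F) in Gal(M/K) divides 24 and is below 12, so it is 1, 2, 3, 4, 6 or 8. *)
  apply: card5_char; rewrite cN dF; move: ltF; rewrite dF (@ltn_pmul2l 5 _ 12 isT).
  have : #|'Gal(M / K) : 'Gal(M / F)|%g \in divisors 24.
    by rewrite -dvdn_divisors // (dvdn_trans _ K24) // dvdn_indexg.
  have /allP all24 : all (fun d => (d < 12) ==>
    (5 * d \in [:: 5; 10; 15; 20; 30; 40])) (divisors 24) by [].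
  by move/all24/implyP.
have := der1_leq_index (isT : prime 5) sFK sK1 iK coK
  (galois_closure_gcore closK) sNX trN nNT chP P5.
by rewrite -(dim_gal_index sFM) // => /(leq_trans der60); rewrite leqNgt ltF.
Qed.

Theorem proposition3p2 (k : fieldType) (L : splittingFieldType k)
    (K Kt : {subfield L})
    (sepK : separable 1 K) (degK : \dim K = 5)
    (nHK : ~ hopf_galois (subvs_of K))
    (closK : galois_closure K Kt) :
  [/\ 'Gal(Kt / 1)%g \isog 'Alt_('I_5) \/ 'Gal(Kt / 1)%g \isog 'Sym_('I_5),
      smallest_hopf_galois_degree K Kt 60,
      'Gal(Kt / 1)%g \isog 'Alt_('I_5) ->
        hopf_galois_between K Kt Kt /\ \dim Kt = 60
    & 'Gal(Kt / 1)%g \isog 'Sym_('I_5) ->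
        exists F : {subfield L},
          [/\ hopf_galois_between K Kt F, \dim F = 60
            & almost_classically_galois F]].
Proof.
have [sKM galM minM] := closK; have coreK := galois_closure_gcore closK.
have sK1 : 'Gal(Kt / K)%g \subset 'Gal(Kt / 1)%g by rewrite galS ?sub1v.
have iK : #|'Gal(Kt / 1) : 'Gal(Kt / K)|%g = 5 by rewrite -(dim_gal_index sKM).
have dimKt : \dim Kt = #|'Gal(Kt / 1)%g|.
  by rewrite -galois_dim // dimv1 divn1.
have [coK [[P defG] | [der60 isoG]]] := degree5_dichotomy sK1 iK coreK.
  by case: nHK; apply: sdprod_hopf_galois sKM galM defG.
have caseA : 'Gal(Kt / 1)%g \isog 'Alt_('I_5) ->
    hopf_galois_between K Kt Kt /\ \dim Kt = 60.
  move=> isoA; rewrite dimKt (card_isog isoA) card_Alt5; split=> //; split=> //.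
  (* The whole Galois group is a normal complement of the trivial group Gal(Kt/Kt). *)
  apply: (sdprod_hopf_galois (N := 'Gal(Kt / 1)%G)) => //.
  by rewrite gal_self sdprodg1.
have caseS : 'Gal(Kt / 1)%g \isog 'Sym_('I_5) -> exists F : {subfield L},
    [/\ hopf_galois_between K Kt F, \dim F = 60 & almost_classically_galois F].
  move=> isoS; have [t [Kt_t ot [N defG]]] :=
    Sym5_involution_complement sK1 iK coreK isoS.
  (* Since t lies in Gal(Kt/K), this field contains K; its degree is 120 / 2. *)
  pose F := [aspace of fixedField <[t]>%g] : {subfield L}.
  have galF : 'Gal(Kt / F)%g = <[t]>%g by apply: gal_fixedField.
  have sFM : (F <= Kt)%VS by apply: fixedField_bound.
  have galMK : galois K Kt by apply: galoisS galM; rewrite sub1v.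
  have sKF : (K <= F)%VS.
    by rewrite -(galois_fixedField galMK) fixedFieldS // cycle_subG.
  have defG' : (N ><| 'Gal(Kt / F) = 'Gal(Kt / 1))%g by rewrite galF.
  exists F; split.
  - by split=> //; apply: sdprod_hopf_galois sFM galM defG'.
  - rewrite (dim_gal_index sFM) // galF -divgS ?cycle_subG ?(subsetP sK1) //.
    by rewrite (card_isog isoS) card_Sym5 -orderE ot.
  exists Kt; last exact: sdprod_normal_regular defG'.
  (* A Galois extension containing F contains K, hence Kt, so Kt is also the closure of F. *)
  by split=> // E sFE; apply: minM; apply: subv_trans sFE.
have K24 : #|'Gal(Kt / K)%g| %| 24.
  rewrite -(dvdn_pmul2r (isT : 0 < 5)) -{1}iK Lagrange //.
  by case: isoG => iso; rewrite (card_isog iso) (card_Alt5, card_Sym5).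
split=> //; split; last by move=> F; apply: hopf_galois_degree_ge60.
case: isoG => [/caseA[HG d60] | /caseS[F [HG d60 _]]]; last by exists F.
by exists Kt.
Qed.
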